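(* Let $X$ be a topological space and $X'\subset X$ an open set, with inclusion $i:X'\hookrightarrow X$, such that both $X$ and $X'$ are paracompact, and let $\mathscr{S}$ be a sheaf of abelian groups on $X$. Then, for any soft resolution $0\to\mathscr{S}\to\mathscr{K}^{\bullet}$ such that each $\mathscr{K}^{q}|_{X'}$ is soft, there is a canonical isomorphism $$H^{q}_{d_{\mathscr{K}}}(i)\simeq H^{q}(X,X';\mathscr{S})$$ for every $q$.
   Context: Sheaves are sheaves of abelian groups; complexes of sheaves $(\mathscr{K}^\bullet,d)$ satisfy $\mathscr{K}^q=0$ for $q<0$. A topological space is paracompact if it is Hausdorff and every open covering admits a locally finite refinement. A sheaf $\mathscr{G}$ on a paracompact space $X$ is soft if $\mathscr{G}(X)\to\mathscr{G}(S)$ is surjective for every closed $S\subset X$. A soft resolution is a resolution by soft sheaves. The relative cohomology $H^q(X,X';\mathscr{S})$ is the $q$-th cohomology of the complex $\mathscr{F}^\bullet(X,X')$ of sections over $X$ that vanish on $X'$, where $0\to\mathscr{S}\to\mathscr{F}^\bullet$ is a flabby resolution (e.g. the Godement resolution). The cohomology $H^q_{d_{\mathscr{K}}}(i)$ of $\mathscr{K}^\bullet$ for the open embedding $i:X'\hookrightarrow X$ is the $q$-th cohomology of the complex $\mathscr{K}^\bullet(i)$ with $\mathscr{K}^q(i)=\mathscr{K}^q(X)\oplus\mathscr{K}^{q-1}(X')$ and differential $d(s,t)=(ds,\ i^{-1}s-dt)$, where $i^{-1}s=s|_{X'}$. *)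

(* Defs.v *)
From HB Require Import structures.
From mathcomp Require Import all_boot all_algebra ring_quotient.
From mathcomp Require Import all_classical.
From mathcomp Require Import topology.

Set Implicit Arguments.
Unset Strict Implicit.
Unset Printing Implicit Defensive.

Import GRing.Theory.
Local Open Scope classical_set_scope.
Local Open Scope ring_scope.

Record opens (X : topologicalType) := Opens {
  oset :> set X;
  openP : open oset }.

Definition opens_top (X : topologicalType) : opens X := Opens openT.

Definition opensI (X : topologicalType) (U V : opens X) : opens X :=
  Opens (openI (openP U) (openP V)).

Lemma opensIl (X : topologicalType) (U V : opens X) : opensI U V `<=` U.
Proof. exact: subIsetl. Qed.

Lemma opensIr (X : topologicalType) (U V : opens X) : opensI U V `<=` V.
Proof. exact: subIsetr. Qed.

Lemma opens_topS (X : topologicalType) (U : opens X) : U `<=` opens_top X.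
Proof. exact: subsetT. Qed.

(* As usual, a refinement of an open covering is itself an open covering. *)
Definition paracompact (X : topologicalType) : Prop :=
  hausdorff_space X /\
  forall C : set (set X), C `<=` open -> \bigcup_(A in C) A = setT ->
    exists D : set (set X),
      [/\ D `<=` open,
          \bigcup_(B in D) B = setT,
          forall B, D B -> exists2 A, C A & B `<=` A
        & forall x : X, exists2 N, nbhs x N &
            finite_set [set B | D B /\ B `&` N !=set0]].

Lemma open_set_val_image (X : topologicalType) (X' : opens X)
  (U : opens (set_type X')) : open (set_val @` (U : set (set_type X'))).
Proof.
have [W oW WU] := openP U.
suff -> : set_val @` (U : set (set_type X')) = W `&` X'.
  exact: openI oW (openP X').
rewrite -WU; apply/seteqP; split=> [_ [y Wy <-]|x [Wx X'x]].
  by split=> //; exact: set_valP.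
by exists (exist _ x (mem_set X'x)).
Qed.

(* An open subset of the subspace X', viewed as an open subset of X. *)
Definition opens_image (X : topologicalType) (X' : opens X)
  (U : opens (set_type X')) : opens X := Opens (open_set_val_image U).

Record presheaf (X : topologicalType) := Presheaf {
  sect :> opens X -> zmodType;
  res : forall U V : opens X, V `<=` U -> {additive sect U -> sect V};
  res_id : forall (U : opens X) (h : U `<=` U) (s : sect U), res h s = s;
  res_res : forall (U V W : opens X) (hVU : V `<=` U) (hWV : W `<=` V)
    (hWU : W `<=` U) (s : sect U), res hWV (res hVU s) = res hWU s }.

Definition separated (X : topologicalType) (F : presheaf X) : Prop :=
  forall (I : Type) (U : opens X) (V : I -> opens X)
    (hVU : forall i, V i `<=` U),
    U `<=` \bigcup_(i in [set: I]) V i ->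
    forall s t : F U, (forall i, res F (hVU i) s = res F (hVU i) t) -> s = t.

Definition gluing (X : topologicalType) (F : presheaf X) : Prop :=
  forall (I : Type) (U : opens X) (V : I -> opens X)
    (hVU : forall i, V i `<=` U),
    U `<=` \bigcup_(i in [set: I]) V i ->
    forall s : forall i, F (V i),
    (forall i j, res F (@opensIl X (V i) (V j)) (s i)
               = res F (@opensIr X (V i) (V j)) (s j)) ->
    exists t : F U, forall i, res F (hVU i) t = s i.

Record sheaf (X : topologicalType) := Sheaf {
  psh :> presheaf X;
  sheaf_separated : separated psh;
  sheaf_gluing : gluing psh }.

Record sheaf_hom (X : topologicalType) (F G : sheaf X) := SheafHom {
  happ :> forall U : opens X, {additive F U -> G U};
  happ_res : forall (U V : opens X) (h : V `<=` U) (s : F U),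
    res G h (happ U s) = happ V (res F h s) }.

Section Restriction.
Variables (X : topologicalType) (X' : opens X) (F : sheaf X).

Let sub_image (U V : opens (set_type X')) :
  V `<=` U -> opens_image V `<=` opens_image U.
Proof. exact: image_subset. Qed.

Definition restr_psh : presheaf (set_type X') :=
  @Presheaf (set_type X') (fun U => F (opens_image U))
    (fun U V h => res F (sub_image h))
    (fun U h s => res_id (sub_image h) s)
    (fun U V W hVU hWV hWU s =>
       res_res (sub_image hVU) (sub_image hWV) (sub_image hWU) s).

Let sub_bigcup I (U : opens (set_type X')) (V : I -> opens (set_type X')) :
  U `<=` \bigcup_(i in [set: I]) V i ->
  opens_image U `<=` \bigcup_(i in [set: I]) opens_image (V i).
Proof. by move=> h _ [y /h[i _ Viy] <-]; exists i => //; exists y. Qed.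

Lemma restr_separated : separated restr_psh.
Proof.
move=> I U V hVU /sub_bigcup cov s t est.
exact: (@sheaf_separated _ F _ _ _ (fun i => sub_image (hVU i)) cov _ _ est).
Qed.

Lemma restr_gluing : gluing restr_psh.
Proof.
move=> I U V hVU /sub_bigcup cov s es.
apply: (@sheaf_gluing _ F _ _ _ (fun i => sub_image (hVU i)) cov) => i j.
have eI : opensI (opens_image (V i)) (opens_image (V j))
          `<=` opens_image (opensI (V i) (V j)).
  move=> _ [[y Viy <-] [z Vjz /val_inj zy]].
  by exists y => //; split=> //; rewrite -zy.
have := congr1 (res F eI) (es i j) => /=.
rewrite (res_res _ eI (@opensIl _ (opens_image (V i)) _)).
by rewrite (res_res _ eI (@opensIr _ _ (opens_image (V j)))).
Qed.

Definition restr : sheaf (set_type X') := Sheaf restr_separated restr_gluing.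

End Restriction.

Definition flabby (X : topologicalType) (F : sheaf X) : Prop :=
  forall (U : opens X) (s : F U),
    exists t : F (opens_top X), res F (@opens_topS X U) t = s.

Definition same_germ (X : topologicalType) (F : sheaf X) (x : X)
  (U V : opens X) (s : F U) (t : F V) : Prop :=
  exists (W : opens X) (hU : W `<=` U) (hV : W `<=` V),
    oset W x /\ res F hU s = res F hV t.

(* The germ at x of a section s over an open neighbourhood U of x, as an
   equivalence class of pairs (V, t). *)
Definition germ (X : topologicalType) (F : sheaf X) (x : X)
  (U : opens X) (s : F U) : set {V : opens X & F V} :=
  [set p | same_germ x s (projT2 p)].

(* sigma restricts to an element of F(S), i.e. to a continuous section over S
   of the etale space of F; its values outside S are irrelevant. *)
Definition section_on (X : topologicalType) (F : sheaf X) (S : set X)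
  (sigma : X -> set {V : opens X & F V}) : Prop :=
  forall x, S x -> exists (U : opens X) (u : F U),
    oset U x /\ forall y, S y -> oset U y -> sigma y = germ y u.

Arguments section_on {X} F S sigma.

Definition soft (X : topologicalType) (F : sheaf X) : Prop :=
  forall S : set X, closed S ->
  forall sigma, section_on F S sigma ->
    exists g : F (opens_top X), forall x, S x -> sigma x = germ x g.

Section Kernel.
Variables (A B : zmodType) (f : {additive A -> B}).

Definition kerp : {pred A} := fun x => f x == 0.

Lemma kerp_zmod_closed : zmod_closed kerp.
Proof.
split=> [|x y /eqP fx /eqP fy]; apply/eqP; first exact: raddf0.
by rewrite raddfB fx fy subr0.
Qed.

HB.instance Definition _ := GRing.isZmodClosed.Build A kerp kerp_zmod_closed.

Record kernel := Kernel { ker_val :> A; ker_valP : ker_val \in kerp }.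

HB.instance Definition _ := [isSub for ker_val].
HB.instance Definition _ := [Choice of kernel by <:].
HB.instance Definition _ := [SubChoice_isSubZmodule of kernel by <:].

Lemma kerP (z : kernel) : f (val z) = 0.
Proof. exact/eqP/(ker_valP z). Qed.

Definition to_ker (x : A) (fx : f x = 0) : kernel := Kernel (introT eqP fx).

End Kernel.

Section KernelMap.
Variables (A B A' B' : zmodType).
Variables (f : {additive A -> B}) (f' : {additive A' -> B'}).
Variables (a : {additive A -> A'}) (b : {additive B -> B'}).
Hypothesis ab : forall x, f' (a x) = b (f x).

Lemma ker_map_subproof (z : kernel f) : f' (a (val z)) = 0.
Proof. by rewrite ab kerP raddf0. Qed.

Definition ker_map (z : kernel f) : kernel f' := to_ker (ker_map_subproof z).

Lemma ker_map_is_zmod_morphism : zmod_morphism ker_map.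
Proof. by move=> x y; apply: val_inj; rewrite /= !raddfB. Qed.

HB.instance Definition _ :=
  GRing.isZmodMorphism.Build (kernel f) (kernel f') ker_map
    ker_map_is_zmod_morphism.

End KernelMap.

(* Complexes are zero in negative degrees, hence indexed by nat. *)
Record cochain := Cochain {
  cobj :> nat -> zmodType;
  cd : forall q, {additive cobj q -> cobj q.+1};
  cdd : forall q (x : cobj q), cd q.+1 (cd q x) = 0 }.

(* The group C^(q-1); 'I_1 is the zero group. *)
Definition cprev (C : cochain) (q : nat) : zmodType :=
  if q is p.+1 then C p else 'I_1.

Definition cdprev (C : cochain) (q : nat) : {additive cprev C q -> C q} :=
  match q return {additive cprev C q -> C q} with
  | 0 => \0
  | p.+1 => cd C p
  end.

Definition cocycles (C : cochain) (q : nat) : zmodType := kernel (cd C q).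

Definition coboundary (C : cochain) (q : nat) : {pred cocycles C q} :=
  fun z => `[< exists y : cprev C q, cdprev C q y = ker_val z >].

Lemma coboundary_zmod_closed (C : cochain) (q : nat) :
  zmod_closed (coboundary (C := C) (q := q)).
Proof.
split=> [|x y]; first by apply/asboolP; exists 0; rewrite raddf0.
move=> /asboolP[u ux] /asboolP[v vy]; apply/asboolP; exists (u - v).
by rewrite raddfB ux vy.
Qed.

HB.instance Definition _ (C : cochain) (q : nat) :=
  GRing.isZmodClosed.Build (cocycles C q) (@coboundary C q)
    (@coboundary_zmod_closed C q).

Definition cohom (C : cochain) (q : nat) : zmodType :=
  Quotient.quot (@coboundary C q).

Definition cclass (C : cochain) (q : nat) : {additive cocycles C q -> cohom C q} :=
  \pi_(cohom C q)%qT.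

Record chain_map (C D : cochain) := ChainMap {
  cmap :> forall q, {additive C q -> D q};
  cmap_d : forall q (x : C q), cd D q (cmap q x) = cmap q.+1 (cd C q x) }.

Section CohomMap.
Variables (C D : cochain) (f : chain_map C D).

Definition cprev_map (q : nat) : {additive cprev C q -> cprev D q} :=
  match q return {additive cprev C q -> cprev D q} with
  | 0 => idfun
  | p.+1 => f p
  end.

Lemma cprev_map_d q (x : cprev C q) :
  cdprev D q (cprev_map q x) = f q (cdprev C q x).
Proof. by case: q x => [|q] x /=; [rewrite raddf0 | rewrite cmap_d]. Qed.

Definition cocycle_map (q : nat) : {additive cocycles C q -> cocycles D q} :=
  ker_map (cmap_d f (q := q)).

Definition cohom_fun (q : nat) (x : cohom C q) : cohom D q :=
  cclass D q (cocycle_map q (repr x)).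

Lemma cohom_funE q (z : cocycles C q) :
  cohom_fun (cclass C q z) = cclass D q (cocycle_map q z).
Proof.
rewrite /cohom_fun; apply/eqP; rewrite -Quotient.idealrBE -raddfB.
have : (repr (cclass C q z) == z %[mod cohom C q])%qT by rewrite reprK.
rewrite -Quotient.idealrBE => /asboolP[y yE].
apply/asboolP; exists (cprev_map q y).
by rewrite cprev_map_d yE.
Qed.

Lemma cohom_fun_is_zmod_morphism q : zmod_morphism (@cohom_fun q).
Proof.
move=> x y; rewrite -[x]reprK -[y]reprK.
have piE z : \pi_(cohom C q)%qT z = cclass C q z by [].
by rewrite !piE -raddfB !cohom_funE !raddfB.
Qed.

HB.instance Definition _ q :=
  GRing.isZmodMorphism.Build (cohom C q) (cohom D q) (@cohom_fun q)
    (@cohom_fun_is_zmod_morphism q).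

Definition cohom_map (q : nat) : {additive cohom C q -> cohom D q} :=
  @cohom_fun q.

End CohomMap.

Record sheaf_complex (X : topologicalType) := SheafComplex {
  sobj :> nat -> sheaf X;
  sd : forall q, sheaf_hom (sobj q) (sobj q.+1);
  sdd : forall q (U : opens X) (s : sobj q U), sd q.+1 U (sd q U s) = 0 }.

(* s is a section over U of the image sheaf of f. *)
Definition in_image (X : topologicalType) (F G : sheaf X) (f : sheaf_hom F G)
  (U : opens X) (s : G U) : Prop :=
  forall x, oset U x -> exists (W : opens X) (hWU : W `<=` U) (t : F W),
    oset W x /\ f W t = res G hWU s.

(* Exactness at G as sheaves: the kernel of g is the image sheaf of f. *)
Definition sheaf_exact (X : topologicalType) (F G H : sheaf X)
  (f : sheaf_hom F G) (g : sheaf_hom G H) : Prop :=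
  forall (U : opens X) (s : G U), g U s = 0 <-> in_image f s.

Record resolution (X : topologicalType) (S : sheaf X) := Resolution {
  rcpx :> sheaf_complex X;
  raug : sheaf_hom S (rcpx 0);
  raug_inj : forall U : opens X, injective (raug U);
  raug_exact : sheaf_exact raug (sd rcpx 0);
  rexact : forall q, sheaf_exact (sd rcpx q) (sd rcpx q.+1) }.

Record resolution_hom (X : topologicalType) (S : sheaf X)
    (K L : resolution S) := ResolutionHom {
  rhom :> forall q, sheaf_hom (K q) (L q);
  rhom_d : forall q (U : opens X) (s : K q U),
    sd L q U (rhom q U s) = rhom q.+1 U (sd K q U s);
  rhom_aug : forall (U : opens X) (s : S U),
    rhom 0 U (raug K U s) = raug L U s }.

Definition flabby_resolution (X : topologicalType) (S : sheaf X)
  (F : resolution S) : Prop := forall q, flabby (F q).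

Definition soft_resolution (X : topologicalType) (S : sheaf X)
  (K : resolution S) : Prop := forall q, soft (K q).

Definition soft_over (X : topologicalType) (X' : opens X) (S : sheaf X)
  (K : resolution S) : Prop := forall q, soft (restr X' (K q)).

Definition sections (X : topologicalType) (K : sheaf_complex X)
  (U : opens X) : cochain :=
  @Cochain (fun q => K q U) (fun q => sd K q U) (fun q s => sdd s).

Section Embedding.
Variables (X : topologicalType) (X' : opens X) (K : sheaf_complex X).
Local Notation KX := (sections K (opens_top X)).
Local Notation KX' := (sections K X').

Definition restr_to (q : nat) : {additive KX q -> KX' q} :=
  res (K q) (@opens_topS X X').

Lemma restr_to_d q (s : KX q) :
  cd KX' q (restr_to q s) = restr_to q.+1 (cd KX q s).
Proof. by rewrite /= happ_res. Qed.

Definition emb_obj (q : nat) : zmodType := (KX q * cprev KX' q)%type.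

Definition emb_diff (q : nat) (x : emb_obj q) : emb_obj q.+1 :=
  (cd KX q x.1, restr_to q x.1 - cdprev KX' q x.2).

Lemma emb_diff_is_zmod_morphism q : zmod_morphism (@emb_diff q).
Proof.
move=> [s t] [s' t']; rewrite /emb_diff; congr pair => /=.
  by rewrite raddfB.
by rewrite !raddfB /= addrACA.
Qed.

HB.instance Definition _ q :=
  GRing.isZmodMorphism.Build (emb_obj q) (emb_obj q.+1) (@emb_diff q)
    (@emb_diff_is_zmod_morphism q).

Lemma emb_diffK q (x : emb_obj q) : emb_diff (emb_diff x) = 0.
Proof.
case: x => s t; rewrite /emb_diff; congr pair => /=; first exact: sdd.
rewrite raddfB /=; have := restr_to_d s => /= ->.
rewrite opprB addrC subrK.
by case: q s t => [|q] s t /=; [exact: raddf0 | exact: sdd].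
Qed.

(* The complex K(i) of the open embedding i : X' -> X. *)
Definition emb_complex : cochain :=
  @Cochain emb_obj (fun q => @emb_diff q) emb_diffK.

(* The complex K(X, X') of sections over X that vanish on X'. *)
Definition rel_obj (q : nat) : zmodType := kernel (restr_to q).

Definition rel_diff (q : nat) : {additive rel_obj q -> rel_obj q.+1} :=
  ker_map (f := restr_to q) (f' := restr_to q.+1) (a := cd KX q) (b := cd KX' q)
    (fun s => esym (restr_to_d s)).

Lemma rel_diffK q (x : rel_obj q) : rel_diff q.+1 (rel_diff q x) = 0.
Proof. by apply: val_inj; exact: sdd. Qed.

Definition rel_complex : cochain := @Cochain rel_obj rel_diff rel_diffK.

(* The inclusion s |-> (s, 0) of K(X, X') into K(i). *)
Definition rel_emb_fun (q : nat) (x : rel_obj q) : emb_obj q := (ker_val x, 0).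

Lemma rel_emb_fun_is_zmod_morphism q : zmod_morphism (@rel_emb_fun q).
Proof. by move=> x y; rewrite /rel_emb_fun; congr pair; rewrite subr0. Qed.

HB.instance Definition _ q :=
  GRing.isZmodMorphism.Build (rel_obj q) (emb_obj q) (@rel_emb_fun q)
    (@rel_emb_fun_is_zmod_morphism q).

Lemma rel_emb_d q (x : rel_complex q) :
  cd emb_complex q (rel_emb_fun x) = rel_emb_fun (cd rel_complex q x).
Proof.
congr pair => /=; rewrite (raddf0 (cdprev KX' q)) subr0.
exact: (kerP (f := restr_to q)).
Qed.

Definition rel_emb : chain_map rel_complex emb_complex :=
  @ChainMap rel_complex emb_complex (fun q => @rel_emb_fun q) rel_emb_d.

End Embedding.

Section EmbeddingMap.
Variables (X : topologicalType) (X' : opens X) (S : sheaf X).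
Variables (K L : resolution S) (f : resolution_hom K L).

Definition sections_map (U : opens X) : chain_map (sections K U) (sections L U) :=
  @ChainMap (sections K U) (sections L U) (fun q => f q U)
    (fun q s => rhom_d f s).

Lemma restr_to_map q (s : K q (opens_top X)) :
  restr_to X' L q (f q _ s) = f q X' (restr_to X' K q s).
Proof. exact: happ_res. Qed.

Definition emb_map_fun (q : nat) (x : emb_obj X' K q) : emb_obj X' L q :=
  (f q _ x.1, cprev_map (sections_map X') q x.2).

Lemma emb_map_fun_is_zmod_morphism q : zmod_morphism (@emb_map_fun q).
Proof. by move=> x y; rewrite /emb_map_fun; congr pair; rewrite raddfB. Qed.

HB.instance Definition _ q :=
  GRing.isZmodMorphism.Build (emb_obj X' K q) (emb_obj X' L q) (@emb_map_fun q)
    (@emb_map_fun_is_zmod_morphism q).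

Lemma emb_map_d q (x : emb_complex X' K q) :
  cd (emb_complex X' L) q (emb_map_fun x) =
  emb_map_fun (cd (emb_complex X' K) q x).
Proof.
case: x => s t; congr pair; first exact: rhom_d.
rewrite [RHS]raddfB [in RHS]/= -restr_to_map.
by rewrite (cprev_map_d (sections_map X')).
Qed.

Definition emb_map : chain_map (emb_complex X' K) (emb_complex X' L) :=
  @ChainMap (emb_complex X' K) (emb_complex X' L) (fun q => @emb_map_fun q)
    emb_map_d.

Definition rel_map_fun (q : nat) : {additive rel_obj X' K q -> rel_obj X' L q} :=
  ker_map (f := restr_to X' K q) (f' := restr_to X' L q)
    (a := f q (opens_top X)) (b := f q X') (@restr_to_map q).

Lemma rel_map_d q (x : rel_complex X' K q) :
  cd (rel_complex X' L) q (rel_map_fun q x) =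
  rel_map_fun q.+1 (cd (rel_complex X' K) q x).
Proof. by apply: val_inj; exact: rhom_d. Qed.

Definition rel_map : chain_map (rel_complex X' K) (rel_complex X' L) :=
  @ChainMap (rel_complex X' K) (rel_complex X' L) rel_map_fun rel_map_d.

End EmbeddingMap.

(* Main.v *)
Require Import Defs.
From HB Require Import structures.
From mathcomp Require Import all_boot all_algebra ring_quotient.
From mathcomp Require Import all_classical.
From mathcomp Require Import topology.

(* Fix an injective resolution I of S.  Every resolution K of S maps to I,
   uniquely up to homotopy, which gives a canonical map H(K(i)) -> H(I(i)).  If
   K is soft on X and on X', the cone of K -> I is a bounded below exact complex
   of soft sheaves; on a paracompact space its sections are exact, hence
   H(K(i)) = H(I(i)).  Flabby sheaves are soft on paracompact spaces, so this
   also applies to a flabby resolution F, for which moreover F(X, X') -> F(i) is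
   a quasi-isomorphism because F(X) -> F(X') is onto.  The canonical
   isomorphism is H(K(i)) = H(I(i)) = H(F(i)) = H(F(X, X')). *)

Set Implicit Arguments.
Unset Strict Implicit.
Unset Printing Implicit Defensive.

Import GRing.Theory Num.Theory.
Local Open Scope classical_set_scope.
Local Open Scope ring_scope.

(** * The divisible group Q/Z *)

(** A soft resolution need not map to a flabby one: on a point, Z -> Q -> Q/Z does not map to Z over
    the identity. Hence the detour through [I]. Injectivity comes from Q/Z: each [I n] is a product
    of copies of Q/Z indexed by points and characters of stalks of a cokernel, so a morphism into it
    is a family of stalk characters and is extended one character at a time. The cone turns the
    comparison of two resolutions into a vanishing statement about one exact complex, which is cut
    into short exact sequences. Softness concerns global sections only, so this vanishing is proved
    on X and on the subspace X' separately. *)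

Definition additive_of (A B : zmodType) (f : A -> B) (fB : zmod_morphism f) :
    {additive A -> B} :=
  HB.pack f (GRing.isZmodMorphism.Build A B f fB).

Lemma subrACA (V : zmodType) (a b c d : V) :
  a - b - (c - d) = a - c - (b - d).
Proof. by rewrite !opprD !opprK addrACA. Qed.

Definition int_rat : {pred rat} := fun x => x \is a Num.int.

Lemma int_rat_zmod_closed : zmod_closed int_rat.
Proof. by split=> [|x y xZ yZ]; [exact: rpred0 | exact: rpredB]. Qed.

HB.instance Definition _ :=
  GRing.isZmodClosed.Build rat int_rat int_rat_zmod_closed.

Definition QmodZ : zmodType := Quotient.quot int_rat.

Definition toQZ : {additive rat -> QmodZ} := \pi_QmodZ%qT.

Lemma toQZ_eq0 (x : rat) : (toQZ x == 0) = (x \is a Num.int).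
Proof. by rewrite -(raddf0 toQZ) -Quotient.idealrBE subr0. Qed.

Lemma toQZ_divn (x : rat) (n : nat) : toQZ (x / n.+1%:R) *+ n.+1 = toQZ x.
Proof.
rewrite -(raddfMn toQZ); congr (toQZ _).
rewrite -[LHS]mulr_natr divfK //.
by rewrite (pnatr_eq0 rat).
Qed.

Lemma QZ_divisible (n : nat) (r : QmodZ) : exists q : QmodZ, q *+ n.+1 = r.
Proof.
exists (toQZ (repr r / n.+1%:R)).
by rewrite toQZ_divn; exact: reprK.
Qed.

Lemma toQZ_unit_fraction (n : nat) : toQZ (1 / n.+2%:R) != 0.
Proof.
rewrite toQZ_eq0 div1r; apply/negP.
rewrite intrEge0; last by rewrite invr_ge0 ler0n.
move=> /natrP[m mE].
have : (n.+2%:R * m%:R : rat) = 1 by rewrite -mE mulfV // (pnatr_eq0 rat).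
rewrite -natrM => /eqP; rewrite (eqr_nat rat _ 1).
by rewrite muln_eq1.
Qed.

(** With [n] the order of an element modulo a subgroup, 0 standing for infinite order, this supplies
    a nonzero value that a character may take on it. *)
Lemma QZ_torsion (n : nat) : n != 1%N ->
  exists2 q : QmodZ, q != 0 & q *+ n = 0.
Proof.
case: n => [|[|n]] // _.
  by exists (toQZ (1 / 2%:R)) => //; exact: toQZ_unit_fraction.
exists (toQZ (1 / n.+2%:R)); first exact: toQZ_unit_fraction.
by rewrite toQZ_divn; apply/eqP; rewrite toQZ_eq0.
Qed.

Lemma int_subgroup (P : int -> Prop) :
  P 0 -> (forall m n, P m -> P n -> P (m - n)) ->
  exists d : nat, forall n, P n <-> (d %| n)%Z.
Proof.
move=> P0 PB.
have PN m : P m -> P (- m) by move=> Pm; rewrite -sub0r; exact: PB.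
have PD m n : P m -> P n -> P (m + n).
  by move=> Pm Pn; rewrite -[n]opprK; apply: PB => //; exact: PN.
have PM d k : P d -> P (k * d).
  move=> Pd; elim/int_rec: k => [|k IH|k IH]; first by rewrite mul0r.
    by rewrite -[k.+1]addn1 PoszD mulrDl mul1r; exact: PD.
  by rewrite mulNr -[k.+1]addn1 PoszD mulrDl mul1r opprD -mulNr; exact: PB.
(* The generator is the least positive element, by division with remainder; if there is none, the
   subgroup is trivial and [d] is 0. *)
have [[d [d0 Pd]]|nP] := pselect (exists d : nat, (0 < d)%N /\ P d).
  have ex : exists d, (0 < d)%N && `[< P d%:Z >].
    by exists d; rewrite d0; apply/asboolP.
  case: (ex_minnP ex) => e /andP[e0 /asboolP Pe] emin; exists e => n; split.
    move=> Pn; apply/dvdz_mod0P.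
    have Pr : P (n %% e)%Z by rewrite /modz; apply: PB => //; exact: PM.
    have r0 : 0 <= (n %% e)%Z by rewrite modz_ge0 // -lt0n.
    have re : (n %% e)%Z < e by rewrite ltz_pmod.
    move: (n %% e)%Z r0 re Pr => [r|//] _ re Pr.
    case: r re Pr => [//|r] re Pr.
    have := emin r.+1; rewrite /= => /(_ (asboolT Pr)).
    by rewrite leqNgt -ltz_nat re.
  by move=> /dvdzP[k ->]; exact: PM.
exists 0%N => n; split=> [Pn|]; last by rewrite dvd0z => /eqP ->.
rewrite dvd0z; apply/eqP; apply: contrapT => n0; apply: nP.
case: n Pn n0 => [[|n]|n] Pn n0; [by []|by exists n.+1|].
by exists n.+1; split=> //; have := PN _ Pn; rewrite NegzE opprK.
Qed.

Section Extension.
Variable G : zmodType.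
Implicit Types (A : set (G * QmodZ)) (g : G) (q r : QmodZ).

(** The graph of a homomorphism from a subgroup of [G] to Q/Z. With graphs, the upper bound of a
    chain is a plain union. *)
Definition partial_hom A : Prop :=
  [/\ A (0, 0),
      forall g q h r, A (g, q) -> A (h, r) -> A (g - h, q - r)
    & forall q, A (0, q) -> q = 0].

Definition adjoin A g q : set (G * QmodZ) :=
  [set u | exists n : int, A (u.1 - g *~ n, u.2 - q *~ n)].

Lemma sub_adjoin A g q : A `<=` adjoin A g q.
Proof. by move=> u Au; exists 0; rewrite !mulr0z !subr0; case: u Au. Qed.

Lemma adjoin_mem A g q : partial_hom A -> adjoin A g q (g, q).
Proof. by move=> [A0 _ _]; exists 1; rewrite /= !mulr1z !subrr. Qed.

(** The condition on [q] is compatibility with the values already fixed on multiples of [g]; it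
    keeps the enlarged graph single-valued. *)
Lemma adjoin_partial_hom A g q : partial_hom A ->
  (forall (n : int) r, A (g *~ n, r) -> r = q *~ n) ->
  partial_hom (adjoin A g q).
Proof.
move=> hA gq; have [A0 AB A1] := hA; split.
- exact: sub_adjoin.
- move=> h r h' r' [m Am] [n An]; exists (m - n) => /=.
  by have := AB _ _ _ _ Am An; rewrite /= !mulrzBr (subrACA h) (subrACA r).
- move=> r [n /=]; rewrite sub0r => Ar.
  have := AB _ _ _ _ A0 Ar; rewrite !sub0r opprK opprB => /gq /eqP.
  by rewrite -subr_eq0 addrAC subrr sub0r oppr_eq0 => /eqP.
Qed.

(** Here [d] is the order of [g] modulo the domain of [A], or 0 if that order is infinite. *)
Lemma multiples A g : partial_hom A ->
  exists d : nat, forall n : int, (exists r, A (g *~ n, r)) <-> (d %| n)%Z.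
Proof.
move=> [A0 AB _]; apply: int_subgroup; first by exists 0; rewrite mulr0z.
move=> m n [r Ar] [s As]; exists (r - s).
by rewrite mulrzBr; exact: AB.
Qed.

Lemma partial_hom_uniq A g q r :
  partial_hom A -> A (g, q) -> A (g, r) -> q = r.
Proof.
move=> [_ AB A1] Aq Ar; have := AB _ _ _ _ Aq Ar.
by rewrite subrr => /A1/eqP; rewrite subr_eq0 => /eqP.
Qed.

Lemma partial_homMz A g q (n : int) :
  partial_hom A -> A (g, q) -> A (g *~ n, q *~ n).
Proof.
move=> [A0 AB _] Ag; elim/int_rec: n => [|n IH|n IH]; first by rewrite !mulr0z.
  have Ng := AB _ _ _ _ A0 Ag; have := AB _ _ _ _ IH Ng.
  by rewrite !sub0r !opprK -!mulrSr.
have := AB _ _ _ _ IH Ag.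
by rewrite !mulrNz -!opprD -!mulrSr.
Qed.

(** Only the value at [g *~ d] constrains [q], and divisibility of Q/Z solves this single equation;
    for [d = 0] there is no constraint. *)
Lemma adjoin_value A g : partial_hom A ->
  exists q, forall (n : int) r, A (g *~ n, r) -> r = q *~ n.
Proof.
move=> hA; have [d dP] := multiples g hA.
suff [q qP] : exists q, forall r, A (g *~ d, r) -> r = q *~ d.
  exists q => n r Ar.
  have /dvdzP[k nE] : (d %| n)%Z by apply/dP; exists r.
  have [s As] : exists s, A (g *~ d, s) by apply/dP; rewrite dvdzz.
  apply: (partial_hom_uniq hA Ar).
  have := partial_homMz k hA As; rewrite (qP _ As) -!mulrzA nE.
  by rewrite [d%:Z * k]mulrC.
case: d {dP} => [|d].
  by exists 0 => r; rewrite !mulr0z; case: hA => _ _; apply.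
have [[r Ar]|nr] := pselect (exists r, A (g *~ d.+1, r)).
  have [q qr] := QZ_divisible d r.
  by exists q => s /(partial_hom_uniq hA Ar) <-; rewrite -qr.
by exists 0 => r Ar; case: nr; exists r.
Qed.

Lemma partial_hom_extend A : partial_hom A ->
  exists f : {additive G -> QmodZ}, forall g q, A (g, q) -> f g = q.
Proof.
move=> hA.
(* Ranging over the sets whose union with [A] is a partial homomorphism, instead of over supersets
   of [A], admits the empty chain: its union [set0] gives back [A]. *)
have [|B [hB Bmax]] := @Zorn_bigcup _ [set B | partial_hom (A `|` B)].
  move=> F FP Ftot.
  have [[B0 FB0]|F0] := pselect (exists B, F B); last first.
    rewrite /= (_ : \bigcup_(X in F) X = set0) ?setU0 //.
    by rewrite -subset0 => x [B FB _]; apply: F0; exists B.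
  have UE u : (A `|` \bigcup_(X in F) X) u -> exists2 B, F B & (A `|` B) u.
    by move=> [Au|[B FB Bu]]; [exists B0; [|left]|exists B; [|right]].
  have EU B u : F B -> (A `|` B) u -> (A `|` \bigcup_(X in F) X) u.
    by move=> FB [Au|Bu]; [left|right; exists B].
  split.
  - by left; case: hA.
  - move=> g q h r /UE[B FB Bg] /UE[C FC Ch].
    have [BC|CB] := Ftot _ _ FB FC.
      apply: (EU C) => //; have [_ + _] := FP _ FC; apply => //.
      by case: Bg => [?|/BC]; [left|right].
    apply: (EU B) => //; have [_ + _] := FP _ FB; apply => //.
    by case: Ch => [?|/CB]; [left|right].
  - by move=> q /UE[B FB]; have [_ _] := FP _ FB; apply.
set C := A `|` B in hB.
have total g : exists q, C (g, q).
  apply: contrapT => gC.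
  have [q qP] := adjoin_value g hB.
  have hD := adjoin_partial_hom hB qP.
  apply: (Bmax (adjoin C g q)).
    split; first by move=> u Bu; apply: sub_adjoin; right.
    by move=> /(_ _ (adjoin_mem g q hB)) Bg; apply: gC; exists q; right.
  rewrite /= (_ : A `|` _ = adjoin C g q) //.
  by apply/setUidPr => u Au; apply: sub_adjoin; left.
have [f fP] := choice total.
have fB : zmod_morphism f.
  move=> g h; apply: (partial_hom_uniq hB (fP _)).
  by have [_ + _] := hB; apply; exact: fP.
by exists (additive_of fB) => g q Ag; apply: (partial_hom_uniq hB (fP g)); left.
Qed.

(* QmodZ is a cogenerator of the category of abelian groups. *)
Lemma character_separation (H : set G) (g : G) :
  H 0 -> (forall x y, H x -> H y -> H (x - y)) -> ~ H g ->
  exists2 f : {additive G -> QmodZ}, (forall h, H h -> f h = 0) & f g != 0.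
Proof.
move=> H0 HB gH.
pose A : set (G * QmodZ) := [set u | H u.1 /\ u.2 = 0].
have hA : partial_hom A.
  split=> [//|x q y r [/= Hx ->] [/= Hy ->]|q [_ //]].
  by split; [exact: HB | rewrite /= subr0].
have [d dP] := multiples g hA.
have d1 : d != 1%N.
  apply/eqP => d1; apply: gH.
  have [|r [/= Hg _]] := (dP 1).2 _; first by rewrite d1.
  by rewrite mulr1z in Hg.
(* Since [d] is the order of [g] modulo [H], any [q] killed by [d] is a consistent value at [g] once
   [H] is sent to 0. *)
have [q q0 qd] := QZ_torsion d1.
have qP (n : int) r : A (g *~ n, r) -> r = q *~ n.
  move=> Ar; have /dvdzP[k ->] : (d %| n)%Z by apply/dP; exists r.
  by case: Ar => /= _ ->; rewrite mulrC mulrzA -pmulrn qd mul0rz.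
have [f fP] := partial_hom_extend (adjoin_partial_hom hA qP).
exists f; last by rewrite (fP g q) //; exact: adjoin_mem.
by move=> h Hh; apply: fP; apply: sub_adjoin; split.
Qed.

End Extension.

(** * Morphisms, germs and sections on subsets *)

Section SheafHom.
Variable X : topologicalType.
Implicit Types F G H : sheaf X.

Definition hom_of F G (f : forall U : opens X, F U -> G U)
    (fB : forall U, zmod_morphism (f U))
    (fres : forall (U V : opens X) (h : V `<=` U) (s : F U),
      res G h (f U s) = f V (res F h s)) : sheaf_hom F G :=
  @SheafHom X F G (fun U => additive_of (fB U)) fres.

Section Operations.
Variables (F G H : sheaf X) (g : sheaf_hom G H) (f f' : sheaf_hom F G).

Lemma comp_hom_B U : zmod_morphism (fun s => g U (f U s)).
Proof. by move=> s t /=; rewrite !raddfB. Qed.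

Lemma comp_hom_res (U V : opens X) (h : V `<=` U) (s : F U) :
  res H h (g U (f U s)) = g V (f V (res F h s)).
Proof. by rewrite !happ_res. Qed.

Definition comp_hom : sheaf_hom F H := hom_of comp_hom_B comp_hom_res.

Lemma sub_hom_B U : zmod_morphism (fun s => f U s - f' U s).
Proof. by move=> s t /=; rewrite (raddfB (f U)) (raddfB (f' U)) subrACA. Qed.

Lemma sub_hom_res (U V : opens X) (h : V `<=` U) (s : F U) :
  res G h (f U s - f' U s) = f V (res F h s) - f' V (res F h s).
Proof. by rewrite raddfB !happ_res. Qed.

Definition sub_hom : sheaf_hom F G := hom_of sub_hom_B sub_hom_res.

Lemma zero_hom_B U : zmod_morphism (fun _ : F U => 0 : G U).
Proof. by move=> s t /=; rewrite subrr. Qed.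

Lemma zero_hom_res (U V : opens X) (h : V `<=` U) (s : F U) :
  res G h 0 = 0 :> G V.
Proof. exact: raddf0. Qed.

Definition zero_hom : sheaf_hom F G := hom_of zero_hom_B zero_hom_res.

Lemma comp_homE (U : opens X) (s : F U) : comp_hom U s = g U (f U s).
Proof. by []. Qed.

Lemma sub_homE (U : opens X) (s : F U) : sub_hom U s = f U s - f' U s.
Proof. by []. Qed.

Lemma zero_homE (U : opens X) (s : F U) : zero_hom U s = 0.
Proof. by []. Qed.

End Operations.

End SheafHom.

Section Germs.
Variables (X : topologicalType) (F : sheaf X).
Implicit Types (U V W : opens X) (x : X).

Lemma same_germ_refl x U (s : F U) : oset U x -> same_germ x s s.
Proof. by move=> Ux; exists U, (fun x h => h), (fun x h => h). Qed.

Lemma same_germ_sym x U V (s : F U) (t : F V) :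
  same_germ x s t -> same_germ x t s.
Proof. by move=> [W [hU [hV [Wx st]]]]; exists W, hV, hU. Qed.

Lemma same_germ_trans x U V W (r : F U) (s : F V) (t : F W) :
  same_germ x r s -> same_germ x s t -> same_germ x r t.
Proof.
move=> [A [hU [hV [Ax rs]]]] [B [kV [kW [Bx st]]]].
have AU : opensI A B `<=` U by move=> y [/hU].
have AV : opensI A B `<=` V by move=> y [/hV].
have BW : opensI A B `<=` W by move=> y [_ /kW].
exists (opensI A B), AU, BW; split=> //.
have := congr1 (res F (@opensIl _ A B)) rs.
have := congr1 (res F (@opensIr _ A B)) st.
by rewrite !(res_res _ _ AU, res_res _ _ BW, res_res _ _ AV) => -> ->.
Qed.

Lemma same_germ_res x U V (h : V `<=` U) (s : F U) :
  oset V x -> same_germ x s (res F h s).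
Proof.
by move=> Vx; exists V, h, (fun x h => h); split=> //; rewrite res_id.
Qed.

Lemma same_germ_near x U V (s : F U) (t : F V) : same_germ x s t ->
  exists2 W : opens X, oset W x & forall y, oset W y -> same_germ y s t.
Proof.
by move=> [W [hU [hV [Wx st]]]]; exists W => // y Wy; exists W, hU, hV.
Qed.

Lemma same_germ_eq U (s t : F U) :
  (forall x, oset U x -> same_germ x s t) -> s = t.
Proof.
move=> st.
have /choice[W WP] : forall x : {x | oset U x}, exists W : opens X,
    exists h : W `<=` U, oset W (sval x) /\ res F h s = res F h t.
  move=> [x Ux]; have [W [h [k [Wx stE]]]] := st x Ux.
  by exists W, h; split=> //; rewrite stE (Prop_irrelevance k h).
pose h i := projT1 (cid (WP i)).
apply: (@sheaf_separated _ F _ U W h).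
  by move=> x Ux; exists (exist _ x Ux) => //; have [? []] := WP (exist _ x Ux).
by move=> x; have [_ ->] := projT2 (cid (WP x)).
Qed.

Lemma same_germB x U V (s s' : F U) (t t' : F V) :
  same_germ x s t -> same_germ x s' t' -> same_germ x (s - s') (t - t').
Proof.
move=> [A [hU [hV [Ax st]]]] [B [kU [kV [Bx st']]]].
have AU : opensI A B `<=` U by move=> y [/hU].
have AV : opensI A B `<=` V by move=> y [/hV].
exists (opensI A B), AU, AV; split=> //; rewrite !raddfB /=.
have := congr1 (res F (@opensIl _ A B)) st.
have := congr1 (res F (@opensIr _ A B)) st'.
by rewrite !(res_res _ _ AU, res_res _ _ AV) => -> ->.
Qed.

(** The condition [oset V x] makes [t] a member of its own germ, so that equality of germs can be
    tested on [t]. *)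
Lemma germP x U V (s : F U) (t : F V) :
  oset V x -> germ x s = germ x t <-> same_germ x s t.
Proof.
move=> Vx; split=> [stE|st].
  have : germ x s (existT _ V t) by rewrite stE; exact: same_germ_refl.
  by [].
apply/seteqP; split=> p /=; last exact: same_germ_trans.
by apply: same_germ_trans; exact: same_germ_sym.
Qed.

Lemma germ_res x U V (h : V `<=` U) (s : F U) :
  oset V x -> germ x (res F h s) = germ x s.
Proof.
by move=> Vx; apply/germP; [exact: h|exact/same_germ_sym/same_germ_res].
Qed.

Lemma section_on_germ (S : set X) U (s : F U) :
  S `<=` U -> section_on F S (fun x => germ x s).
Proof. by move=> SU x /SU Ux; exists U, s. Qed.

(** Local representatives of [sigma] have equal germs on overlaps, hence agree there and glue. *)
Lemma glue_section (U : opens X) sigma : section_on F U sigma ->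
  exists t : F U, forall x, oset U x -> sigma x = germ x t.
Proof.
move=> sU.
have /choice[a aP] : forall x : {x | oset U x}, exists a : {V : opens X & F V},
    projT1 a `<=` U /\ oset (projT1 a) (sval x) /\
    forall y, oset (projT1 a) y -> sigma y = germ y (projT2 a).
  move=> [x Ux]; have [V [v [Vx vE]]] := sU x Ux.
  exists (existT _ (opensI U V) (res F (@opensIr _ U V) v)) => /=.
  split; first exact: opensIl.
  by split=> // y [Uy Vy]; rewrite germ_res //; exact: vE.
have [] := @sheaf_gluing _ F {x | oset U x} U (fun i => projT1 (a i))
  (fun i => (aP i).1) _ (fun i => projT2 (a i)).
- by move=> x Ux; exists (exist _ x Ux) => //; have [_ []] := aP (exist _ x Ux).
- move=> i j; apply: same_germ_eq => x [ix jx].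
  apply: (same_germ_trans (s := projT2 (a i))).
    by apply/same_germ_sym/same_germ_res.
  apply: (same_germ_trans (s := projT2 (a j))); last exact: same_germ_res.
  by apply/germP => //; rewrite -(aP i).2.2 // -(aP j).2.2.
- move=> t tE; exists t => x Ux; have [aU [ax aE]] := aP (exist _ x Ux).
  by rewrite aE // -(tE (exist _ x Ux)) germ_res.
Qed.

End Germs.

Section PushGerm.
Variables (X : topologicalType) (F G : sheaf X) (p : sheaf_hom F G).

Lemma same_germ_hom x (U V : opens X) (s : F U) (t : F V) :
  same_germ x s t -> same_germ x (p U s) (p V t).
Proof.
move=> [W [hU [hV [Wx st]]]]; exists W, hU, hV; split=> //.
by rewrite !happ_res st.
Qed.

(** The map on stalks induced by [p]; collecting the images of all representatives avoids choosing
    one. *)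
Definition push_germ (x : X) (a : set {V : opens X & F V}) :
    set {V : opens X & G V} :=
  [set b | exists2 u, a u & same_germ x (p _ (projT2 u)) (projT2 b)].

Lemma push_germE x (U : opens X) (s : F U) :
  oset U x -> push_germ x (germ x s) = germ x (p U s).
Proof.
move=> Ux; apply/seteqP; split=> [b [u /= su]|b /= sb].
  by apply: same_germ_trans; exact: same_germ_hom.
by exists (existT _ U s) => //; exact: same_germ_refl.
Qed.

Lemma section_on_push (S : set X) sigma :
  section_on F S sigma -> section_on G S (fun x => push_germ x (sigma x)).
Proof.
move=> sS x /sS[U [u [Ux uE]]]; exists U, (p U u); split=> // y Sy Uy.
by rewrite uE // push_germE.
Qed.

End PushGerm.

(** Presents a monomorphism as the second map of an exact pair, so that one extension lemma also
    covers the augmentation. *)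
Lemma zero_sheaf_exact (X : topologicalType) (F G : sheaf X)
  (f : sheaf_hom F G) :
  (forall U : opens X, injective (f U)) -> sheaf_exact (zero_hom F F) f.
Proof.
move=> finj U s; split=> [fs0 x Ux|si].
  have -> : s = 0 by apply: (finj U); rewrite fs0 raddf0.
  by exists U, (fun x h => h), 0; split=> //; rewrite (raddf0 (res F _)).
suff -> : s = 0 by exact: raddf0.
apply: same_germ_eq => x Ux; have [W [h [t [Wx tE]]]] := si x Ux.
by exists W, h, h; split=> //; rewrite -tE raddf0.
Qed.

(** * Injective sheaves *)

Section DependentProduct.
Variables (I : Type) (M : I -> zmodType).

Definition dprod : Type := forall i, M i.

Implicit Types f g h : dprod.

HB.instance Definition _ := gen_eqMixin dprod.
HB.instance Definition _ := gen_choiceMixin dprod.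

Definition dprod_zero : dprod := fun=> 0.
Definition dprod_opp f : dprod := fun i => - f i.
Definition dprod_add f g : dprod := fun i => f i + g i.

Lemma dprod_addA : associative dprod_add.
Proof.
by move=> f g h; apply/functional_extensionality_dep => i; exact: addrA.
Qed.

Lemma dprod_addC : commutative dprod_add.
Proof.
by move=> f g; apply/functional_extensionality_dep => i; exact: addrC.
Qed.

Lemma dprod_add0 : left_id dprod_zero dprod_add.
Proof. by move=> f; apply/functional_extensionality_dep => i; exact: add0r. Qed.

Lemma dprod_addN : left_inverse dprod_zero dprod_opp dprod_add.
Proof. by move=> f; apply/functional_extensionality_dep => i; exact: addNr. Qed.

HB.instance Definition _ :=
  GRing.isZmodule.Build dprod dprod_addA dprod_addC dprod_add0 dprod_addN.

Lemma dprodBE (f g : dprod) i : (f - g) i = f i - g i.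
Proof. by []. Qed.

End DependentProduct.

Section Characters.
Variables (X : topologicalType) (x : X).

(* Such a family is a character of the stalk of F at x; its components at open
   sets not containing x are irrelevant. *)
Definition stalk_char (F : sheaf X) (c : forall V : opens X, F V -> QmodZ) :=
  (forall V : opens X, zmod_morphism (c V)) /\
  forall (V W : opens X) (h : W `<=` V) (s : F V),
    oset W x -> c W (res F h s) = c V s.

Section FromProduct.
Variables (F : sheaf X) (phi : {additive dprod F -> QmodZ}).
Hypothesis phi0 : forall (w : dprod F) (W : opens X), oset W x ->
  (forall V : opens X, V `<=` W -> w V = 0) -> phi w = 0.

Definition restrictions (U : opens X) (s : F U) : dprod F := fun V =>
  if pselect (V `<=` U) is left h then res F h s else 0.

Lemma restrictionsE (U V : opens X) (h : V `<=` U) (s : F U) :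
  restrictions s V = res F h s.
Proof.
rewrite /restrictions; case: pselect => // k.
by rewrite (Prop_irrelevance h k).
Qed.

(** The families of [s] and of its restriction to [W] agree on all open sets inside [W], and [phi0]
    makes [phi] blind to the other components. *)
Lemma stalk_char_of_product :
  stalk_char (fun (V : opens X) (s : F V) => phi (restrictions s)).
Proof.
split=> [V s t|V W h s Wx].
  rewrite -raddfB; congr (phi _); apply/functional_extensionality_dep => U.
  rewrite [RHS]dprodBE /restrictions.
  by case: pselect => h; [exact: raddfB|rewrite [RHS]subr0].
apply/eqP; rewrite -subr_eq0 -raddfB; apply/eqP; apply: (phi0 Wx) => U UW.
rewrite [LHS]dprodBE.
rewrite (restrictionsE UW) (restrictionsE (subset_trans UW h)).
by rewrite (res_res h UW (subset_trans UW h)) subrr.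
Qed.

End FromProduct.

(* Injectivity of QmodZ on stalks; the product over all open sets plays the
   role of the stalk. *)
Lemma stalk_char_extend (P Q R : sheaf X) (f : sheaf_hom P Q)
  (g : sheaf_hom Q R) (c : forall V : opens X, Q V -> QmodZ) :
  sheaf_exact f g -> stalk_char c ->
  (forall (V : opens X) (s : P V), oset V x -> c V (f V s) = 0) ->
  exists2 c' : forall V : opens X, R V -> QmodZ, stalk_char c' &
    forall (V : opens X) (s : Q V), oset V x -> c' V (g V s) = c V s.
Proof.
move=> fg hc cf; have [cB cres] := hc.
(* A family equal to [g s] near [x] is sent to [c s]. This is single-valued by exactness, because
   [c] vanishes on the image of [f]. *)
pose A : set (dprod R * QmodZ) := [set u | exists (W : opens X) (s : Q W),
  [/\ oset W x, c W s = u.2 & forall (V : opens X) (h : V `<=` W),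
    u.1 V = g V (res Q h s)]].
have c0 (V : opens X) : c V 0 = 0 by rewrite -(subr0 0) cB subrr.
have hA : partial_hom A.
  split.
  - exists (opens_top X), 0; split=> //= V h.
    by rewrite !raddf0.
  - move=> w q w' q' [W [s [/= Wx sq ws]]] [W' [s' [/= Wx' sq' ws']]].
    exists (opensI W W'); exists (res Q (@opensIl _ W W') s -
      res Q (@opensIr _ W W') s'); split => //=.
      by rewrite cB !cres // sq sq'.
    move=> V h; have hW : V `<=` W by move=> y /h[].
    have hW' : V `<=` W' by move=> y /h[].
    rewrite [LHS]dprodBE (ws _ hW) (ws' _ hW') !raddfB.
    by rewrite (res_res _ _ hW) (res_res _ _ hW').
  - move=> q [W [s [/= Wx <- ws]]].
    have := ws W (fun y h => h); rewrite -[LHS]/0 res_id => /esym /fg si.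
    have [V [h [t [Vx tE]]]] := si x Wx.
    by rewrite -(cres _ _ h) // -tE cf.
have [phi phiP] := partial_hom_extend hA.
exists (fun V s => phi (restrictions s)).
  (* A family vanishing near [x] has value 0 in [A], through the zero section. *)
  apply: stalk_char_of_product => w W Wx w0; apply: phiP.
  by exists W, 0; split=> //= V h; rewrite w0 // !raddf0.
move=> V s Vx; apply: phiP; exists V, s; split=> //= W h.
by rewrite (restrictionsE h) happ_res.
Qed.

(** The cogenerator property of Q/Z, applied to the subgroup [H] of families that near [x] come from
    a section of [P]. *)
Lemma stalk_char_separation (P Q : sheaf X) (f : sheaf_hom P Q)
  (U : opens X) (s : Q U) : oset U x ->
  (forall (W : opens X) (h : W `<=` U) (t : P W), oset W x ->
     f W t <> res Q h s) ->
  exists2 c : forall V : opens X, Q V -> QmodZ, stalk_char c &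
    (forall (V : opens X) (t : P V), oset V x -> c V (f V t) = 0) /\
    c U s <> 0.
Proof.
move=> Ux sf.
pose H : set (dprod Q) := [set w | exists (W : opens X) (t : P W),
  oset W x /\ forall (V : opens X) (h : V `<=` W), w V = f V (res P h t)].
have [|w w'||phi phiH phis] := @character_separation _ H (restrictions s).
- by exists (opens_top X), 0; split=> // V h; rewrite !raddf0.
- move=> [W [t [Wx wt]]] [W' [t' [Wx' wt']]].
  exists (opensI W W'); exists (res P (@opensIl _ W W') t -
      res P (@opensIr _ W W') t'); split => // V h.
  have hW : V `<=` W by move=> y /h[].
  have hW' : V `<=` W' by move=> y /h[].
  rewrite [LHS]dprodBE (wt _ hW) (wt' _ hW') !raddfB.
  by rewrite (res_res _ _ hW) (res_res _ _ hW').
- move=> [W [t [Wx wt]]].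
  have hU : opensI U W `<=` U by exact: opensIl.
  apply: (sf _ hU (res P (@opensIr _ U W) t)) => //.
  by rewrite -wt (restrictionsE hU).
exists (fun V s => phi (restrictions s)).
  apply: stalk_char_of_product => w W Wx w0; apply: phiH.
  by exists W, 0; split=> // V h; rewrite w0 // !raddf0.
split; last exact/eqP.
move=> V t Vx; apply: phiH; exists V, t; split=> // W h.
by rewrite (restrictionsE h) happ_res.
Qed.

End Characters.

(* The sheaf U |-> prod_(x in U) prod_c Q/Z, where c runs over the characters
   of the stalk of the cokernel of f at x. *)
Section CokernelCharacters.
Variables (X : topologicalType) (A B : sheaf X) (f : sheaf_hom A B).

Record coker_char := CokerChar {
  cc_pt : X;
  cc_fun :> forall V : opens X, B V -> QmodZ;
  cc_stalk : stalk_char cc_pt cc_fun;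
  cc_ker : forall (V : opens X) (s : A V), oset V cc_pt -> cc_fun (f V s) = 0 }.

Definition cc_sect (U : opens X) : zmodType :=
  ({c : coker_char | oset U (cc_pt c)} -> QmodZ)%type.

Definition cc_res_fun (U V : opens X) (h : V `<=` U) (s : cc_sect U) :
  cc_sect V := fun c => s (exist _ (sval c) (h _ (svalP c))).

Lemma cc_res_B (U V : opens X) (h : V `<=` U) : zmod_morphism (cc_res_fun h).
Proof. by []. Qed.

Definition cc_res (U V : opens X) (h : V `<=` U) :
  {additive cc_sect U -> cc_sect V} := additive_of (cc_res_B h).

Lemma cc_res_id (U : opens X) (h : U `<=` U) (s : cc_sect U) : cc_res h s = s.
Proof. by apply/funext => -[c Uc]; congr (s _); exact: eq_exist. Qed.

Lemma cc_res_res (U V W : opens X) (hVU : V `<=` U) (hWV : W `<=` V)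
  (hWU : W `<=` U) (s : cc_sect U) : cc_res hWV (cc_res hVU s) = cc_res hWU s.
Proof. by apply/funext => -[c Uc]; congr (s _); exact: eq_exist. Qed.

Definition cc_psh : presheaf X := Presheaf cc_res_id cc_res_res.

Lemma cc_separated : Defs.separated cc_psh.
Proof.
move=> I U V hVU cov s t st; apply/funext => -[c Uc].
have [i _ Vic] := cov _ Uc.
have := congr1 (@^~ (exist _ c Vic)) (st i).
rewrite /= /cc_res_fun /=; set u := exist _ _ _.
by rewrite (_ : u = exist _ c Uc) //; exact: eq_exist.
Qed.

Lemma cc_gluing : gluing cc_psh.
Proof.
move=> I U V hVU cov s ss.
have /choice[k kP] : forall c : {c : coker_char | oset U (cc_pt c)},
    exists i, oset (V i) (cc_pt (sval c)).
  by move=> [c Uc]; have [i _ Vic] := cov _ Uc; exists i.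
exists (fun c => s (k c) (exist _ (sval c) (kP c))) => i.
apply/funext => -[c Vc] /=; rewrite /cc_res_fun /=.
set u := exist _ c _; have Vkc := kP u.
have := congr1 (@^~ (exist _ c (conj Vkc Vc))) (ss (k u) i).
rewrite /= /cc_res_fun /=; set a := exist _ _ _; set b := exist _ _ _ => ab.
rewrite (_ : exist _ _ _ = a); last exact: eq_exist.
by rewrite ab; congr (s i _); exact: eq_exist.
Qed.

Definition cc_sheaf : sheaf X := Sheaf cc_separated cc_gluing.

Lemma cc_flabby : flabby cc_sheaf.
Proof.
move=> U s.
exists (fun c : {c : coker_char | oset (opens_top X) (cc_pt c)} =>
  if pselect (oset U (cc_pt (sval c))) is left Uc
  then s (exist _ (sval c) Uc) else 0).
apply/funext => -[c Uc] /=; rewrite /cc_res_fun /=.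
by case: pselect => // Uc'; congr (s _); exact: eq_exist.
Qed.

Definition cc_eval_fun (U : opens X) (s : B U) : cc_sheaf U :=
  fun c => sval c U s.

Lemma cc_eval_B (U : opens X) : zmod_morphism (@cc_eval_fun U).
Proof.
by move=> s t; apply/funext => c; have [cB _] := cc_stalk (sval c); exact: cB.
Qed.

Lemma cc_eval_res (U V : opens X) (h : V `<=` U) (s : B U) :
  res cc_sheaf h (cc_eval_fun s) = cc_eval_fun (res B h s).
Proof.
apply/funext => -[c Vc]; have [_ cres] := cc_stalk c.
by rewrite /cc_eval_fun /= cres.
Qed.

Definition cc_eval : sheaf_hom B cc_sheaf := hom_of cc_eval_B cc_eval_res.

(** A section outside the image at some point is detected by a character from
    [stalk_char_separation], and that character is a coordinate of [cc_eval]. *)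
Lemma cc_exact : sheaf_exact f cc_eval.
Proof.
move=> U s; split=> [s0 x Ux|si].
  apply: contrapT => sf.
  have [||c cP [cf cs]] := @stalk_char_separation _ x _ _ f U s.
  - by [].
  - by move=> W h t Wx ft; apply: sf; exists W, h, t.
  apply: cs; exact: (congr1 (@^~ (exist _ (CokerChar cP cf) Ux)) s0).
apply/funext => -[c Uc]; have [W [h [t [Wx tE]]]] := si _ Uc.
have [_ cres] := cc_stalk c.
by rewrite /= /cc_eval_fun /= -(cres _ _ h) // -tE cc_ker.
Qed.

(** Injectivity phrased for an exact pair, so that it directly yields the next component of a chain
    map or of a homotopy. Each stalk character is extended on its own. *)
Lemma cc_injective (P Q R : sheaf X) (u : sheaf_hom P Q) (v : sheaf_hom Q R)
  (k : sheaf_hom Q cc_sheaf) :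
  sheaf_exact u v -> (forall (U : opens X) s, k U (u U s) = 0) ->
  exists l : sheaf_hom R cc_sheaf, forall (U : opens X) s, l U (v U s) = k U s.
Proof.
move=> uv ku.
(* The coordinate of k at c is a character of the stalk of Q. *)
pose e (c : coker_char) (V : opens X) (s : Q V) : QmodZ :=
  if pselect (oset V (cc_pt c)) is left Vc then k V s (exist _ c Vc) else 0.
have eE (c : coker_char) (V : opens X) (s : Q V) (Vc : oset V (cc_pt c)) :
    e c V s = k V s (exist _ c Vc).
  by rewrite /e; case: pselect => // Vc'; rewrite (Prop_irrelevance Vc' Vc).
have eS c : stalk_char (cc_pt c) (e c).
  split=> [V s t|V W h s Wc].
    by rewrite /e; case: pselect => [Vc|_]; rewrite ?subr0 // raddfB.
  rewrite !eE //; first exact: h.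
  move=> Vc; rewrite -happ_res /= /cc_res_fun /=.
  by congr (k V s _); exact: eq_exist.
have /choice[d dP] : forall c, exists d : forall V : opens X, R V -> QmodZ,
    stalk_char (cc_pt c) d /\
    forall (V : opens X) s, oset V (cc_pt c) -> d V (v V s) = e c V s.
  move=> c; have [|d dS dv] := stalk_char_extend uv (eS c); last by exists d.
  by move=> V s Vc; rewrite eE ku.
pose l (U : opens X) (s : R U) : cc_sheaf U := fun c => d (sval c) U s.
have lB U : zmod_morphism (l U).
  by move=> s t; apply/funext => c; have [[dB _] _] := dP (sval c); exact: dB.
have lres (U V : opens X) (h : V `<=` U) s :
    res cc_sheaf h (l U s) = l V (res R h s).
  apply/funext => -[c Vc]; have [[_ dres] _] := dP c.
  by rewrite /l /= dres.
exists (hom_of lB lres) => U s; apply/funext => -[c Uc] /=.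
by have [_ dv] := dP c; rewrite /l /= dv // eE.
Qed.

End CokernelCharacters.

(** * The injective resolution *)

Lemma sheaf_exact0 (X : topologicalType) (F G H : sheaf X) (f : sheaf_hom F G)
  (g : sheaf_hom G H) (U : opens X) (s : F U) :
  sheaf_exact f g -> g U (f U s) = 0.
Proof.
move=> fg; apply/fg => x Ux; exists U, (fun x h => h), s.
by rewrite res_id.
Qed.

Section InjectiveResolution.
Variables (X : topologicalType) (S : sheaf X).

Record arrow := Arrow {
  arrow_src : sheaf X;
  arrow_tgt : sheaf X;
  arrow_hom : sheaf_hom arrow_src arrow_tgt }.

(** The start is the zero endomorphism of [S], whose cokernel is [S]: arrow 1 is then the
    augmentation and arrow [n.+2] the differential of degree [n]. *)
Fixpoint inj_arrow (n : nat) : arrow :=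
  if n is m.+1 then Arrow (cc_eval (arrow_hom (inj_arrow m)))
  else Arrow (zero_hom S S).

Definition inj_obj (n : nat) : sheaf X := cc_sheaf (arrow_hom (inj_arrow n)).

Definition inj_d (n : nat) : sheaf_hom (inj_obj n) (inj_obj n.+1) :=
  arrow_hom (inj_arrow n.+2).

Definition inj_aug : sheaf_hom S (inj_obj 0) := arrow_hom (inj_arrow 1).

Lemma inj_exact n : sheaf_exact (inj_d n) (inj_d n.+1).
Proof. exact: cc_exact. Qed.

Lemma inj_aug_exact : sheaf_exact inj_aug (inj_d 0).
Proof. exact: cc_exact. Qed.

Lemma inj_dd n (U : opens X) (s : inj_obj n U) : inj_d n.+1 U (inj_d n U s) = 0.
Proof. exact/sheaf_exact0/inj_exact. Qed.

Lemma inj_aug_inj (U : opens X) : injective (inj_aug U).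
Proof.
apply: raddf_inj => s /(@cc_exact _ _ _ (zero_hom S S)) s0.
apply: same_germ_eq => x Ux; have [W [h [t [Wx tE]]]] := s0 x Ux.
by exists W, h, h; split=> //; rewrite raddf0 -tE.
Qed.

Definition inj_resolution : resolution S :=
  @Resolution X S (SheafComplex inj_dd) inj_aug inj_aug_inj inj_aug_exact
    inj_exact.

Lemma inj_flabby : flabby_resolution inj_resolution.
Proof. by move=> q; exact: cc_flabby. Qed.

Local Notation I := inj_resolution.

Lemma inj_extend (n : nat) (P Q R : sheaf X) (u : sheaf_hom P Q)
  (v : sheaf_hom Q R) (k : sheaf_hom Q (I n)) :
  sheaf_exact u v -> (forall (U : opens X) s, k U (u U s) = 0) ->
  exists l : sheaf_hom R (I n), forall (U : opens X) s, l U (v U s) = k U s.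
Proof. exact: cc_injective. Qed.

Lemma inj_lift (K : resolution S) : exists f : resolution_hom K I, True.
Proof.
have [||h0 h0P] := @inj_extend 0 _ _ _ (zero_hom S S) (raug K) (raug I).
- exact/zero_sheaf_exact/raug_inj.
- by move=> U s; rewrite zero_homE raddf0.
have [|h1 h1P] := @inj_extend 1 _ _ _ (raug K) (sd K 0)
    (comp_hom (sd I 0) h0) (@raug_exact _ _ K).
  by move=> U s; rewrite comp_homE h0P; exact/sheaf_exact0/inj_aug_exact.
(* The recursion carries two consecutive components and their commutation, which makes the next
   extension problem solvable. *)
pose T n := {p : sheaf_hom (K n) (I n) * sheaf_hom (K n.+1) (I n.+1) |
  forall (U : opens X) s, p.2 U (sd K n U s) = sd I n U (p.1 U s)}.
have step n (t : T n) : exists h : sheaf_hom (K n.+2) (I n.+2),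
    forall (U : opens X) s, h U (sd K n.+1 U s) = sd I n.+1 U ((sval t).2 U s).
  have [|h hP] := @inj_extend n.+2 _ _ _ (sd K n) (sd K n.+1)
    (comp_hom (sd I n.+1) (sval t).2) (@rexact _ _ K n); last by exists h.
  by move=> U s; rewrite comp_homE (svalP t); exact: sdd.
pose t : forall n, T n := nat_rect T (exist _ (h0, h1) h1P)
  (fun n t => exist _ ((sval t).2, projT1 (cid (step n t)))
                      (projT2 (cid (step n t)))).
have tE n : (sval (t n.+1)).1 = (sval (t n)).2 by [].
have td n (U : opens X) (s : K n U) :
    sd I n U ((sval (t n)).1 U s) = (sval (t n.+1)).1 U (sd K n U s).
  by rewrite tE (svalP (t n)).
by exists (ResolutionHom td h0P).
Qed.

Lemma inj_lift_homotopy (K : resolution S) (f g : resolution_hom K I) :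
  exists s : forall n, sheaf_hom (K n.+1) (I n),
    (forall (U : opens X) (x : K 0 U),
      s 0 U (sd K 0 U x) = f 0 U x - g 0 U x) /\
    forall n (U : opens X) (x : K n.+1 U),
      s n.+1 U (sd K n.+1 U x) = f n.+1 U x - g n.+1 U x - sd I n U (s n U x).
Proof.
pose e n := sub_hom (f n) (g n).
have ed n (U : opens X) (x : K n U) :
    e n.+1 U (sd K n U x) = sd I n U (e n U x).
  by rewrite !sub_homE raddfB !rhom_d.
have [|s0 s0P] := @inj_extend 0 _ _ _ (raug K) (sd K 0) (e 0)
    (@raug_exact _ _ K).
  by move=> U x; rewrite sub_homE !rhom_aug subrr.
(* Applying [sd I n] to the homotopy relation removes the previous component of the homotopy; this
   weaker invariant suffices for the next extension. *)
pose T n := {s : sheaf_hom (K n.+1) (I n) |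
  forall (U : opens X) x, sd I n U (s U (sd K n U x)) = sd I n U (e n U x)}.
have t0P (U : opens X) x : sd I 0 U (s0 U (sd K 0 U x)) = sd I 0 U (e 0 U x).
  by rewrite s0P.
have step n (t : T n) : exists s : sheaf_hom (K n.+2) (I n.+1),
    forall (U : opens X) x,
      s U (sd K n.+1 U x) = e n.+1 U x - sd I n U (sval t U x).
  have [|s sP] := @inj_extend n.+1 _ _ _ (sd K n) (sd K n.+1)
    (sub_hom (e n.+1) (comp_hom (sd I n) (sval t))) (@rexact _ _ K n).
    by move=> U x; rewrite sub_homE comp_homE ed -(svalP t) subrr.
  by exists s.
have stepP n (t : T n) (s := projT1 (cid (step n t))) (U : opens X) x :
    sd I n.+1 U (s U (sd K n.+1 U x)) = sd I n.+1 U (e n.+1 U x).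
  by rewrite (projT2 (cid (step n t))) raddfB sdd subr0.
pose t : forall n, T n := nat_rect T (exist _ s0 t0P)
  (fun n t => exist _ (projT1 (cid (step n t))) (@stepP n t)).
exists (fun n => sval (t n)); split; first exact: s0P.
by move=> n U x; exact: (projT2 (cid (step n (t n)))).
Qed.

End InjectiveResolution.

(** * Cohomology classes and homotopy invariance *)

Section Cohomology.
Variables (C : cochain) (q : nat).

Lemma cclass_surj (x : cohom C q) : exists z : cocycles C q, cclass C q z = x.
Proof. by exists (repr x); exact: reprK. Qed.

Lemma cclassP (z z' : cocycles C q) :
  cclass C q z = cclass C q z' <->
  exists y : cprev C q, cdprev C q y = val z - val z'.
Proof.
have E : (z - z' \in @coboundary C q) = (cclass C q z == cclass C q z').
  exact: Quotient.idealrBE.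
split=> [/eqP|zz']; first by rewrite -E => /asboolP.
by apply/eqP; rewrite -E; apply/asboolP.
Qed.

End Cohomology.

Lemma zero_group_eq (x y : 'I_1) : x = y.
Proof. by rewrite (ord1 x) (ord1 y). Qed.

(** The induced homotopy is [(k, t) |-> (s k, - s t)], its sign matching the one in [emb_diff].
    Degrees 0 and 1 stand apart because there [t], respectively its image, lies in the zero
    group. *)
Lemma emb_homotopy (X : topologicalType) (X' : opens X) (S : sheaf X)
  (K L : resolution S) (f g : resolution_hom K L)
  (s : forall n, sheaf_hom (K n.+1) (L n)) :
  (forall (U : opens X) (x : K 0 U), s 0 U (sd K 0 U x) = f 0 U x - g 0 U x) ->
  (forall n (U : opens X) (x : K n.+1 U),
    s n.+1 U (sd K n.+1 U x) = f n.+1 U x - g n.+1 U x - sd L n U (s n U x)) ->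
  forall q (x : cohom (emb_complex X' K) q),
    cohom_map (emb_map X' f) q x = cohom_map (emb_map X' g) q x.
Proof.
move=> s0 sS q x; have [z <-] := cclass_surj x.
rewrite [LHS]cohom_funE [RHS]cohom_funE; apply/cclassP => /=.
have : cd (emb_complex X' K) q (ker_val z) = 0 := kerP z.
move: (ker_val z) => [k t] [/= dk] /eqP; rewrite subr_eq0 => /eqP.
move: k t dk; case: q {x z} => [|[|q]] k t dk kt.
- exists 0; rewrite raddf0; congr pair; last exact: zero_group_eq.
  by rewrite -s0 dk raddf0.
- exists (s 0 _ k, 0); congr pair => /=; last first.
    by rewrite subr0 happ_res -s0 -kt.
  by apply/eqP; rewrite eq_sym -subr_eq0 -sS dk raddf0.
- exists (s q.+1 _ k, - s q _ t); congr pair => /=.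
    by apply/eqP; rewrite eq_sym -subr_eq0 -sS dk raddf0.
  have := sS q _ t; rewrite -kt /restr_to happ_res => ->.
  by rewrite raddfN opprK subrK.
Qed.

(** * Paracompact spaces *)

Section Paracompact.
Variable X : topologicalType.
Implicit Types (x y : X) (D E : set (set X)).

Lemma near_finite (T : Type) (F : set (set T)) (P : set T -> X -> Prop) x :
  finite_set F -> (forall B, F B -> \forall y \near x, P B y) ->
  \forall y \near x, forall B, F B -> P B y.
Proof.
move=> /finite_seqP[s ->]; elim: s => [|B s IH] FP.
  by apply: nearW => y B.
have /IH sP C : [set` s] C -> \forall y \near x, P C y.
  by move=> sC; apply: FP; rewrite /= inE sC orbT.
have BP : \forall y \near x, P B y by apply: FP; rewrite /= inE eqxx.
apply: filterS2 BP sP => y By sy C /=; rewrite inE => /orP[/eqP -> //|].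
exact: sy.
Qed.

Definition locally_finite E := forall x, exists2 N, nbhs x N &
  finite_set [set B | E B /\ B `&` N !=set0].

Lemma open_witness x (A : set X) : nbhs x A ->
  exists W : opens X, oset W x /\ W `<=` A.
Proof. by rewrite nbhsE => -[V [oV Vx] VA]; exists (Opens oV). Qed.

(** A neighbourhood of [x] meets finitely many members; those that miss [x] are closed and can be
    cut out of it. *)
Lemma locally_finite_star E x : locally_finite E -> E `<=` closed ->
  exists W : opens X, [/\ oset W x,
    forall B y, E B -> B y -> oset W y -> B x
    & finite_set [set B | E B /\ B x]].
Proof.
move=> lfE Ecl; have [N Nx finN] := lfE x.
have : \forall y \near x, forall B, E B /\ B `&` N !=set0 -> B y -> B x.
  apply: near_finite => // B [EB _].
  have [Bx|nBx] := pselect (B x); first exact: nearW.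
  have : nbhs x (~` B).
    by apply: open_nbhs_nbhs; split=> //; exact: closed_openC (Ecl _ EB).
  by apply: filterS => y.
move=> /(filterI Nx)/open_witness[W [Wx WP]]; exists W; split=> //.
  by move=> B y EB By /WP[Ny]; apply=> //; split=> //; exists y.
apply: sub_finite_set finN => B [EB Bx]; split=> //; exists x; split=> //.
exact: nbhs_singleton.
Qed.

Lemma closed_locally_finite E : locally_finite E -> E `<=` closed ->
  closed (\bigcup_(B in E) B).
Proof.
move=> lfE Ecl; rewrite -openC openE => x /= nEx; rewrite /interior.
have [W [Wx WP _]] := locally_finite_star x lfE Ecl.
apply: filterS (open_nbhs_nbhs (conj (openP W) Wx)) => y Wy [B EB By].
by apply: nEx; exists B => //; exact: WP By Wy.
Qed.

Lemma locally_finiteS D E : D `<=` E -> locally_finite E -> locally_finite D.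
Proof.
move=> DE lfE x; have [N Nx finN] := lfE x; exists N => //.
by apply: sub_finite_set finN => B [/DE].
Qed.

Hypothesis pX : paracompact X.

Lemma paracompact_regular x (U : set X) : open U -> U x ->
  exists V : set X, [/\ open V, V x & closure V `<=` U].
Proof.
have [hX cX] := pX; move=> oU Ux.
pose C : set (set X) := [set A | open A /\ (A = U \/
  exists B, [/\ open B, B x & A `&` B = set0])].
have [||D [Dop Dcov DC Dlf]] := cX C.
- by move=> A [].
- apply/seteqP; split=> // y _.
  have [<-|/eqP xy] := pselect (x = y).
    by exists U => //; split=> //; left.
  move: hX; rewrite open_hausdorff => /(_ _ _ xy).
  move=> [[B A] [/= /set_mem Bx /set_mem Ay]].
  move=> [oB oA /eqP AB]; exists A => //; split=> //; right; exists B.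
  by split=> //; rewrite setIC.
have [N Nx finN] := Dlf x.
(* A member of [D] not inside [U] lies in a set separated from [x], so a neighbourhood of [x] inside
   [N] misses all such members. Members meeting it lie in [U], and they cover its closure. *)
have : \forall y \near x, forall B, D B /\ B `&` N !=set0 ->
    ~ B `<=` U -> ~ B y.
  apply: near_finite => // B [DB _].
  have [BU|nBU] := pselect (B `<=` U); first exact: nearW.
  have [A [oA [AU|[W [oW Wx AW]]]] BA] := DC B DB.
    by case: nBU; rewrite -AU.
  apply: filterS (open_nbhs_nbhs (conj oW Wx)) => y Wy _ /BA Ay.
  by have : (A `&` W) y by []; rewrite AW.
move=> /(filterI Nx)/open_witness[W [Wx WP]].
exists W; split=> //; first exact: openP.
move=> y Wy; have [B DB By] : (\bigcup_(B in D) B) y by rewrite Dcov.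
have [BU|nBU] := pselect (B `<=` U); first exact: BU.
have [z [Wz Bz]] := Wy B (open_nbhs_nbhs (conj (Dop B DB) By)).
have [Nz /(_ B)] := WP z Wz; case=> //; split=> //; by exists z.
Qed.

(** Regularity provides a cover by open sets whose closures lie in members of [C]; the members of a
    locally finite refinement of it can be replaced by their closures. *)
Lemma closed_refinement (C : set (set X)) :
  C `<=` open -> (forall x, exists2 A, C A & A x) ->
  exists E : set (set X), [/\ E `<=` closed, locally_finite E,
    forall x, exists2 B, E B & B x
    & forall B, E B -> exists2 A, C A & B `<=` A].
Proof.
move=> Cop Ccov; have [hX cX] := pX.
pose C' : set (set X) := [set V | open V /\ exists2 A, C A & closure V `<=` A].
have [V [] //||D [Dop Dcov DC Dlf]] := cX C'.
  apply/seteqP; split=> // x _; have [A CA Ax] := Ccov x.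
  have [V [oV Vx VA]] := paracompact_regular (Cop A CA) Ax.
  by exists V => //; split=> //; exists A.
exists [set closure B | B in D]; split.
- by move=> _ [B _ <-]; exact: closed_closure.
(* The interior is taken because an open set meeting [closure B] meets [B]. *)
- move=> x; have [N Nx finN] := Dlf x; exists N°; first exact: nbhs_interior.
  apply: sub_finite_set (finite_image closure finN).
  move=> _ [[B DB <-] [y [By Ny]]].
  exists B => //; split=> //; have [z [Bz Nz]] := By _ Ny.
  by exists z.
- move=> x; have [B DB Bx] : (\bigcup_(B in D) B) x by rewrite Dcov.
  by exists (closure B); [exists B | exact: subset_closure].
- move=> _ [B DB <-]; have [V [_ [A CA VA]] BV] := DC B DB; exists A => //.
  by apply: subset_trans VA; exact: closureS.
Qed.

End Paracompact.

(** * Soft sheaves on paracompact spaces *)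

Section Softness.
Variables (X : topologicalType) (pX : paracompact X).

(** Flabbiness makes the local representatives of [sigma] global; over a locally finite closed cover
    they glue on an open neighbourhood of [S], and a last extension concludes. *)
Lemma flabby_soft (F : sheaf X) : flabby F -> soft F.
Proof.
move=> fF S Scl sigma sS.
pose C : set (set X) := [set A | open A /\ exists u : F (opens_top X),
  forall y, S y -> A y -> sigma y = germ y u].
have [|x|E [Ecl lfE Ecov EC]] := closed_refinement pX (C := C).
- by move=> A [].
- have [Sx|nSx] := pselect (S x); last first.
    exists (~` S) => //; split; first exact: closed_openC.
    by exists 0.
  have [U [u [Ux uE]]] := sS x Sx; have [v vu] := fF U u.
  exists U => //; split; first exact: openP.
  by exists v => y Sy Uy; rewrite uE // -vu germ_res.
have /choice[u uE] : forall B, exists u : F (opens_top X), E B ->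
    forall y, S y -> B y -> sigma y = germ y u.
  move=> B; have [EB|nEB] := pselect (E B); last by exists 0.
  have [A [_ [u uP]] BA] := EC B EB; exists u => _ y Sy /BA.
  exact: uP.
have /choice[b bP] : forall x, exists B, E B /\ B x.
  by move=> x; have [B EB Bx] := Ecov x; exists B.
(* The u B glue on the open set where those of them that are relevant agree. *)
pose W : set X :=
  [set x | forall B, E B -> B x -> germ x (u B) = germ x (u (b x))].
(* Near a point of [W] only the finitely many members through it count, and their representatives
   agree on a common neighbourhood. *)
have WN x : W x -> exists U : opens X, oset U x /\
    forall y B, oset U y -> E B -> B y -> germ y (u B) = germ y (u (b x)).
  move=> Wx; have [N [Nx NP finN]] := locally_finite_star x lfE Ecl.
  have : \forall y \near x, forall B, E B /\ B x ->
      germ y (u B) = germ y (u (b x)).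
    apply: near_finite => // B [EB Bx].
    have /germP/same_germ_near := Wx B EB Bx; case=> // V Vx VE.
    apply: filterS (open_nbhs_nbhs (conj (openP V) Vx)) => y Vy.
    by apply/germP => //; exact: VE.
  move=> /(filterI (open_nbhs_nbhs (conj (openP N) Nx)))/open_witness.
  move=> [U [Ux UP]].
  exists U; split=> // y B /UP[Ny Uy] EB By; apply: Uy; split=> //.
  exact: NP By Ny.
have oW : open W.
  rewrite openE => x /WN[U [Ux UP]].
  apply: filterS (open_nbhs_nbhs (conj (openP U) Ux)) => y Uy B EB By.
  by rewrite (UP y B) // (UP y (b y)) //; have [] := bP y.
have [t tE] : exists t : F (Opens oW),
    forall x, W x -> germ x (u (b x)) = germ x t.
  apply: (@glue_section _ _ (Opens oW) (fun x => germ x (u (b x)))).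
  move=> x /WN[U [Ux UP]]; exists U, (res F (@opens_topS _ U) (u (b x))).
  split=> // y _ Uy; rewrite germ_res //; apply: UP => //.
    by have [] := bP y.
  by have [] := bP y.
have [g gt] := fF _ t; exists g => x Sx.
have Wx : W x.
  by move=> B EB Bx; rewrite -(uE B) // -(uE (b x)) //; have [] := bP x.
rewrite (uE (b x)) //; try by have [] := bP x.
by rewrite tE // -gt germ_res.
Qed.

Section Lifting.
Variables (P Q R : sheaf X) (j : sheaf_hom P Q) (p : sheaf_hom Q R).
Hypotheses (softP : soft P) (softQ : soft Q).
Hypothesis j_inj : forall U : opens X, injective (j U).
Hypothesis jp : sheaf_exact j p.
Hypothesis p_surj : forall (U : opens X) (r : R U), in_image p r.

Lemma same_germ_inj x (U V : opens X) (s : P U) (t : P V) :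
  same_germ x (j U s) (j V t) -> same_germ x s t.
Proof.
move=> [W [hU [hV [Wx st]]]]; exists W, hU, hV; split=> //.
by apply: (@j_inj W); rewrite -!happ_res.
Qed.

(* Softness of P moves the lift h so that it agrees with g on T. *)
Lemma adjust_lift (T : set X) (g h : Q (opens_top X)) : closed T ->
  (forall x, T x -> same_germ x (p _ g) (p _ h)) ->
  exists h' : Q (opens_top X), p _ h' = p _ h /\
    forall x, T x -> same_germ x g h'.
Proof.
move=> Tcl gh.
(* The germ of [P] sent to that of [h - g]: on [T] it exists by exactness and is unique because [j]
   is injective. *)
pose kappa x : set {V : opens X & P V} :=
  [set b | same_germ x (j _ (projT2 b)) (h - g)].
have kappaS : section_on P T kappa.
  move=> x /gh/same_germ_sym[W [hU [hV [Wx st]]]].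
  have /jp/(_ x Wx)[V [hVW [a [Vx aE]]]] : p W (res Q hU (h - g)) = 0.
    rewrite -happ_res (raddfB (p _)) raddfB st (Prop_irrelevance hU hV).
    exact: subrr.
  exists V, a; split=> // y Ty Vy.
  have ay : same_germ y (j V a) (h - g).
    rewrite aE (res_res _ _ (@opens_topS _ V)).
    exact/same_germ_sym/same_germ_res.
  apply/seteqP; split=> b /= bP; last first.
    by apply: (same_germ_trans _ ay); exact/same_germ_hom/same_germ_sym.
  by apply: same_germ_inj; exact/(same_germ_trans ay)/same_germ_sym.
have [k kE] := softP Tcl kappaS.
exists (h - j _ k); split.
  by rewrite raddfB (sheaf_exact0 _ jp) subr0.
move=> x Tx.
have : same_germ x (j _ k) (h - g).
  have : kappa x (existT (fun V : opens X => P V) _ k).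
    by rewrite kE //; exact: same_germ_refl.
  by [].
move=> /(same_germB (same_germ_refl h _))/same_germ_sym.
by rewrite opprB addrC subrK; apply.
Qed.

(** Equal germs at a common point mean agreement around it, so [g] on [T] and [h] on [T'] form a
    section over the closed union, which softness of [Q] extends. *)
Lemma union_section (T T' : set X) (g h : Q (opens_top X)) :
  closed T -> closed T' ->
  (forall x, T x -> T' x -> same_germ x g h) ->
  exists k : Q (opens_top X), (forall x, T x -> same_germ x k g) /\
    forall x, T' x -> same_germ x k h.
Proof.
move=> Tcl T'cl gh.
pose tau x := if pselect (T x) then germ x g else germ x h.
have [|k kE] := @softQ (T `|` T') (closedU Tcl T'cl) tau.
  have resE (y : X) (U : opens X) (s : Q (opens_top X)) :
      oset U y -> germ y (res Q (@opens_topS _ U) s) = germ y s.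
    by move=> Uy; rewrite germ_res.
  move=> x TT'x.
  have [Tx|nTx] := pselect (T x); last first.
    exists (Opens (closed_openC Tcl)), (res Q (@opens_topS _ _) h).
    by split=> // y _ nTy; rewrite resE // /tau; case: pselect.
  have [T'x|nT'x] := pselect (T' x).
    have [W Wx WP] := same_germ_near (gh x Tx T'x).
    exists W, (res Q (@opens_topS _ _) g); split=> // y _ Wy.
    rewrite resE // /tau; case: pselect => //= _.
    by apply/germP => //; exact/same_germ_sym/WP.
  exists (Opens (closed_openC T'cl)), (res Q (@opens_topS _ _) g).
  by split=> // y [Ty|T'y] nT'y; rewrite resE // /tau; case: pselect.
exists k; split=> x Tx.
  have := kE x (or_introl Tx); rewrite /tau; case: pselect => //= _.
  by move=> /esym/germP; apply.
have := kE x (or_intror Tx); rewrite /tau.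
case: pselect => [T1x|_] /= /esym/germP.
  by move=> /(_ I) kg; apply: (same_germ_trans kg); exact: gh.
exact.
Qed.

Section ClosedCover.
Variables (S : set X) (E : set (set X)) (gl : set X -> Q (opens_top X)).
Hypotheses (Scl : closed S) (Ecl : E `<=` closed) (lfE : locally_finite E).
Hypothesis Ecov : forall x, S x -> exists2 B, E B & B x.
Variable sigma : X -> set {V : opens X & R V}.
Hypothesis glE : forall B x, E B -> S x -> B x -> sigma x = germ x (p _ (gl B)).

(* A lift of sigma over the union of the members of pl_dom; it is kept as a
   global section, which softness of Q allows.  Zorn's lemma is applied to the
   preorder pl_le. *)
Record partial_lift := PartialLift {
  pl_dom : set (set X);
  pl_lift : Q (opens_top X);
  pl_sub : pl_dom `<=` E;
  pl_E : forall x B, S x -> pl_dom B -> B x -> sigma x = germ x (p _ pl_lift) }.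

Definition pl_le (a b : partial_lift) : Prop :=
  pl_dom a `<=` pl_dom b /\ forall x B, S x -> pl_dom a B -> B x ->
    germ x (pl_lift a) = germ x (pl_lift b).

Lemma closed_union (J : set (set X)) : J `<=` E ->
  closed (S `&` \bigcup_(B in J) B).
Proof.
move=> JE; apply: closedI => //; apply: closed_locally_finite.
  exact: locally_finiteS lfE.
exact: subset_trans JE Ecl.
Qed.

(** Used with the finitely many members of [E] through a point: near it, one lift of the chain
    represents all of them. *)
Lemma chain_finite (A : set partial_lift) (F : set (set X)) :
  total_on A pl_le -> A !=set0 -> finite_set F ->
  exists2 a, A a & forall B b, F B -> A b -> pl_dom b B -> pl_dom a B.
Proof.
move=> Atot [a0 Aa0] /finite_seqP[s ->]; elim: s => [|B s [a Aa aP]].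
  by exists a0.
have [[b [Ab bB]]|nB] := pselect (exists b, A b /\ pl_dom b B); last first.
  exists a => // C b /=; rewrite inE => /orP[/eqP -> Ab bB|sC].
    by case: nB; exists b.
  exact: aP.
have [[ab _]|[ba _]] := Atot _ _ Aa Ab.
  exists b => // C c /=; rewrite inE => /orP[/eqP -> //|sC] Ac cC.
  by apply: ab; exact: aP cC.
exists a => // C c /=; rewrite inE => /orP[/eqP -> _ _|]; first exact: ba.
exact: aP.
Qed.

(** The lifts of the chain define a section over a closed set, locally equal to one of them;
    softness of [Q] makes it global. *)
Lemma chain_bound (A : set partial_lift) : total_on A pl_le -> A !=set0 ->
  exists b, forall a, A a -> pl_le a b.
Proof.
move=> Atot A0.
pose J : set (set X) := \bigcup_(a in A) pl_dom a.
have JE : J `<=` E by move=> B [a _]; exact: pl_sub.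
pose T := S `&` \bigcup_(B in J) B.
have /choice[c cP] : forall x, exists a, T x ->
    A a /\ exists2 B, pl_dom a B & B x.
  move=> x; have [[Sx [B [a Aa aB] Bx]]|nTx] := pselect (T x).
    by exists a => _; split=> //; exists B.
  by have [a _] := A0; exists a.
pose tau x := germ x (pl_lift (c x)).
have tauE a x B : A a -> S x -> pl_dom a B -> B x -> tau x = germ x (pl_lift a).
  move=> Aa Sx aB Bx.
  have [|Ac [C cC Cx]] := cP x; first by split=> //; exists B => //; exists a.
  have [[_ ac]|[_ ca]] := Atot _ _ Aa Ac; first by rewrite (ac x B).
  by rewrite /tau (ca x C).
have [|g gE] := @softQ T (closed_union JE) tau.
  move=> x Tx; have [W [Wx WP finW]] := locally_finite_star x lfE Ecl.
  have [a Aa aP] := chain_finite Atot A0 finW.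
  exists W, (res Q (@opens_topS _ _) (pl_lift a)).
  split=> // y [Sy [B [b Ab bB] By]] Wy.
  rewrite germ_res // (tauE a y B) //; apply: (aP B b) => //.
  by have EB := pl_sub bB; split=> //; exact: WP By Wy.
have gP a x B : A a -> S x -> pl_dom a B -> B x ->
    germ x (pl_lift a) = germ x g.
  move=> Aa Sx aB Bx; rewrite -gE -?(tauE a x B) //.
  by split=> //; exists B => //; exists a.
have gR x B : S x -> J B -> B x -> sigma x = germ x (p _ g).
  move=> Sx [a Aa aB] Bx; rewrite (pl_E Sx aB Bx).
  by rewrite -!push_germE // (gP a x B).
exists (PartialLift JE gR) => a Aa; split=> [B aB|x B Sx aB Bx].
  by exists a.
exact: gP aB Bx.
Qed.

(** [adjust_lift] makes the lift on [B] agree with the partial lift on the overlap, and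
    [union_section] glues the two. *)
Lemma extend_lift (a : partial_lift) (B : set X) : E B ->
  exists2 b, pl_le a b & pl_dom b B.
Proof.
move=> EB; case: a => J g JE gE.
have Tcl := closed_union JE; set T := S `&` _ in Tcl.
have gT x : T x -> sigma x = germ x (p _ g).
  by move=> [Sx [C JC Cx]]; exact: gE JC Cx.
have Bcl : closed (S `&` B) by apply: closedI => //; exact: Ecl.
have [||h' [ph' gh']] := @adjust_lift (T `&` (S `&` B)) g (gl B).
- exact: closedI.
- by move=> x [Tx [Sx Bx]]; apply/germP => //; rewrite -gT // -glE.
have [|k [kg kh]] := union_section Tcl Bcl (g := g) (h := h').
  by move=> x Tx Bx; apply: gh'.
have JBE : J `|` [set B] `<=` E by move=> C [/JE|->].
have kP x C : S x -> (J `|` [set B]) C -> C x -> sigma x = germ x (p _ k).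
  move=> Sx [JC|->] Cx.
    have Tx : T x by split=> //; exists C.
    by rewrite gT //; apply/germP => //; exact/same_germ_hom/same_germ_sym/kg.
  rewrite (glE EB) // -ph'; apply/germP => //.
  exact/same_germ_hom/same_germ_sym/kh.
exists (PartialLift JBE kP); last by right.
split=> [C JC|x C Sx JC Cx] /=; first by left.
by apply/germP => //; apply/same_germ_sym/kg; split=> //; exists C.
Qed.

Lemma full_lift : exists g : Q (opens_top X),
  forall x, S x -> sigma x = germ x (p _ g).
Proof.
have a0P x B : S x -> (@set0 (set X)) B -> B x ->
  sigma x = germ x (p (opens_top X) 0) by [].
pose a0 := PartialLift (@sub0set _ E) a0P.
have [|||a amax] := @ZL_preorder _ a0 (fun a b => `[< pl_le a b >]).
- by move=> a; apply/asboolP; split.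
- move=> b a c /asboolP[ba baE] /asboolP[ac acE]; apply/asboolP; split.
    exact: subset_trans ac.
  by move=> x B Sx bB Bx; rewrite (baE x B) // (acE x B) //; exact: ba.
- move=> A Atot; have [A0|A0] := pselect (A !=set0); last first.
    by exists a0 => a Aa; case: A0; exists a.
  have [|b bP] := @chain_bound A _ A0.
    move=> a b Aa Ab.
    by have [/asboolP|/asboolP] := Atot a b Aa Ab; [left|right].
  by exists b => a Aa; apply/asboolP; exact: bP.
exists (pl_lift a) => x Sx; have [B EB Bx] := Ecov Sx.
apply: pl_E Bx => //.
have [b ab bB] := extend_lift a EB.
by have /asboolP[ba _] := amax b (asboolT ab); exact: ba.
Qed.

End ClosedCover.

(** Local lifts over the members of a locally finite closed cover become global by softness of [Q],
    and [full_lift] assembles them. *)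
Lemma soft_lift (S : set X) sigma : closed S -> section_on R S sigma ->
  exists g : Q (opens_top X), forall x, S x -> sigma x = germ x (p _ g).
Proof.
move=> Scl sS.
pose C : set (set X) := [set A | exists (V : opens X) (q : Q V),
  A = oset V /\ forall y, S y -> oset V y -> sigma y = germ y (p V q)].
have [|x|E [Ecl lfE Ecov EC]] := closed_refinement pX (C := C).
- by move=> _ [V [_ [-> _]]]; exact: openP.
- have [Sx|nSx] := pselect (S x); last first.
    by exists (~` S) => //; exists (Opens (closed_openC Scl)), 0.
  have [U [u [Ux uE]]] := sS x Sx.
  have [W [hW [q [Wx qE]]]] := p_surj u Ux.
  exists W => //; exists W, q; split=> // y Sy Wy.
  by rewrite qE germ_res // uE //; exact: (hW _ Wy).
have /choice[gl glE] : forall B, exists g : Q (opens_top X), E B ->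
    forall x, S x -> B x -> sigma x = germ x (p _ g).
  move=> B; have [EB|nEB] := pselect (E B); last by exists 0.
  have [_ [V [q [-> qE]]] BV] := EC B EB.
  have [g gE] := softQ (Ecl B EB) (section_on_germ q BV).
  exists g => _ x Sx Bx; rewrite qE //; last exact: BV.
  by rewrite -!push_germE ?gE //; exact: BV.
apply: (@full_lift S E gl) => //.
by move=> B x EB Sx Bx; exact: glE.
Qed.

Lemma soft_quotient : soft R.
Proof.
move=> S Scl sigma sS; have [g gE] := soft_lift Scl sS.
by exists (p _ g).
Qed.

Lemma soft_surjective (r : R (opens_top X)) :
  exists g : Q (opens_top X), p _ g = r.
Proof.
have [|g gE] := @soft_lift setT (fun x => germ x r) closedT.
  exact: section_on_germ.
by exists g; apply: same_germ_eq => x _; apply/germP => //; rewrite gE.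
Qed.

End Lifting.

End Softness.

(** * Exact complexes of soft sheaves *)

Lemma sheaf_exactI (X : topologicalType) (F G H : sheaf X)
  (f : sheaf_hom F G) (g : sheaf_hom G H) :
  (forall (U : opens X) s, g U (f U s) = 0) ->
  (forall (U : opens X) s, g U s = 0 -> in_image f s) -> sheaf_exact f g.
Proof.
move=> gf0 fg U s; split; first exact: fg.
move=> si; apply: same_germ_eq => x Ux; have [W [h [t [Wx tE]]]] := si x Ux.
by exists W, h, h; split=> //; rewrite happ_res -tE gf0 raddf0.
Qed.

Lemma trivial_soft (X : topologicalType) (F : sheaf X) :
  (forall (U : opens X) (s t : F U), s = t) -> soft F.
Proof.
move=> F0 S Scl sigma sS; exists 0 => x Sx.
have [U [u [Ux ->//]]] := sS x Sx; apply/germP => //.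
by exists U, (fun x h => h), (@opens_topS _ U); split=> //; exact: F0.
Qed.

(** For softness, [H] behaves as a product; this form applies to a product sheaf and to its
    restriction to a subspace alike. *)
Lemma joint_soft (X : topologicalType) (F G H : sheaf X)
  (p : sheaf_hom H F) (p' : sheaf_hom H G) :
  (forall (U : opens X) (s t : H U),
    p U s = p U t -> p' U s = p' U t -> s = t) ->
  (forall g g', exists h : H (opens_top X), p _ h = g /\ p' _ h = g') ->
  soft F -> soft G -> soft H.
Proof.
move=> pinj psurj sF sG S Scl sigma sS.
have [g gE] := sF S Scl _ (section_on_push p sS).
have [g' gE'] := sG S Scl _ (section_on_push p' sS).
have [h [hg hg']] := psurj g g'; exists h => x Sx.
have [U [u [Ux uE]]] := sS x Sx.
have := gE x Sx; have := gE' x Sx; rewrite uE // !push_germE // -hg -hg'.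
have Tx : oset (opens_top X) x by [].
move=> /(germP _ _ Tx)[B [kU [kV [Bx st2]]]].
move=> /(germP _ _ Tx)[A [hU [hV [Ax st1]]]].
apply/germP => //.
have AU : opensI A B `<=` U by move=> y [/hU].
have AV : opensI A B `<=` opens_top X by [].
exists (opensI A B), AU, AV; split=> //; apply: pinj; rewrite -!happ_res.
  have := congr1 (res F (@opensIl _ A B)) st1.
  by rewrite (res_res _ _ AU) (res_res _ _ AV).
have := congr1 (res G (@opensIr _ A B)) st2.
by rewrite (res_res _ _ AU) (res_res _ _ AV).
Qed.

Section KernelSheaf.
Variables (X : topologicalType) (F G : sheaf X) (d : sheaf_hom F G).

Definition ker_res (U V : opens X) (h : V `<=` U) :
    {additive kernel (d U) -> kernel (d V)} :=
  ker_map (f := d U) (f' := d V) (a := res F h) (b := res G h)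
    (fun s => esym (happ_res d h s)).

Lemma ker_res_id (U : opens X) (h : U `<=` U) (s : kernel (d U)) :
  ker_res h s = s.
Proof. by apply: val_inj; exact: res_id. Qed.

Lemma ker_res_res (U V W : opens X) (hVU : V `<=` U) (hWV : W `<=` V)
  (hWU : W `<=` U) (s : kernel (d U)) :
  ker_res hWV (ker_res hVU s) = ker_res hWU s.
Proof. by apply: val_inj; exact: res_res. Qed.

Definition ker_psh : presheaf X := Presheaf ker_res_id ker_res_res.

Lemma ker_separated : Defs.separated ker_psh.
Proof.
move=> I U V hVU cov s t st; apply: val_inj.
apply: (@sheaf_separated _ F _ _ _ hVU cov) => i.
exact: (congr1 val (st i)).
Qed.

Lemma ker_gluing : gluing ker_psh.
Proof.
move=> I U V hVU cov s ss.
have [i j|t tE] := @sheaf_gluing _ F _ _ _ hVU cov (fun i => ker_val (s i)).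
  exact: (congr1 val (ss i j)).
have dt : d U t = 0.
  apply: (@sheaf_separated _ G _ _ _ hVU cov) => i.
  by rewrite raddf0 happ_res tE; exact: (kerP (s i)).
by exists (to_ker dt) => i; apply: val_inj; exact: tE.
Qed.

Definition ker_sheaf : sheaf X := Sheaf ker_separated ker_gluing.

Definition ker_incl : sheaf_hom ker_sheaf F :=
  @hom_of _ ker_sheaf F (fun U (s : ker_sheaf U) => ker_val s)
    (fun U s t => erefl) (fun U V h s => erefl).

Lemma ker_incl_inj (U : opens X) : injective (ker_incl U).
Proof. by move=> s t st; apply: val_inj. Qed.

Variables (E : sheaf X) (f : sheaf_hom E F).
Hypothesis df : forall (U : opens X) (s : E U), d U (f U s) = 0.

Definition ker_corestr_fun (U : opens X) (s : E U) : ker_sheaf U :=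
  to_ker (df s).

Lemma ker_corestr_B (U : opens X) : zmod_morphism (@ker_corestr_fun U).
Proof. by move=> s t; apply: val_inj; exact: raddfB. Qed.

Lemma ker_corestr_res (U V : opens X) (h : V `<=` U) (s : E U) :
  res ker_sheaf h (ker_corestr_fun s) = ker_corestr_fun (res E h s).
Proof. by apply: val_inj; exact: happ_res. Qed.

Definition ker_corestr : sheaf_hom E ker_sheaf :=
  hom_of ker_corestr_B ker_corestr_res.

End KernelSheaf.

Definition acyclic (C : cochain) : Prop :=
  forall q (x : C q), cd C q x = 0 -> exists y : cprev C q, cdprev C q y = x.

Section ExactComplex.
Variables (X : topologicalType) (C : sheaf_complex X).
Hypothesis C_inj : forall U : opens X, injective (sd C 0 U).
Hypothesis C_exact : forall q, sheaf_exact (sd C q) (sd C q.+1).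

(** The complex splits into short exact sequences of kernel sheaves [Z q]. As [Z 0] is trivial,
    softness passes from [Z q] to [Z q.+1], and [p q] is onto on global sections. *)
Lemma exact_soft_acyclic : paracompact X -> (forall q, soft (C q)) ->
  acyclic (sections C (opens_top X)).
Proof.
move=> pX Csoft.
pose Z q := ker_sheaf (sd C q).
pose p q : sheaf_hom (C q) (Z q.+1) := ker_corestr (@sdd _ C q).
have jp q : sheaf_exact (ker_incl (sd C q)) (p q).
  apply: sheaf_exactI => U s.
    by apply: val_inj; exact: (kerP (s : kernel (sd C q U))).
  move=> ps0 x Ux.
  have ds : sd C q U s = 0 := congr1 val ps0.
  exists U, (fun x h => h), (to_ker ds); split=> //.
  by rewrite res_id.
have psurj q (U : opens X) (r : Z q.+1 U) : in_image (p q) r.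
  move=> x Ux; have /C_exact/(_ x Ux)[W [h [t [Wx tE]]]] := kerP r.
  by exists W, h, t; split=> //; apply: val_inj.
have Zsoft q : soft (Z q).
  elim: q => [|q IH].
    apply: trivial_soft => U s t; apply: val_inj; apply: (@C_inj U).
    by rewrite (kerP s) (kerP t).
  exact: (soft_quotient pX IH (Csoft q) (@ker_incl_inj _ _ _ _) (jp q)
            (psurj q)).
case=> [|q] x dx.
  by exists 0; rewrite raddf0; apply: (@C_inj (opens_top X)); rewrite raddf0.
have [y yx] := soft_surjective pX (Zsoft q) (Csoft q)
  (@ker_incl_inj _ _ _ _) (jp q) (psurj q) (to_ker dx : Z q.+1 _).
by exists y; exact: (congr1 val yx).
Qed.

End ExactComplex.

Section RestrictedComplex.
Variables (X : topologicalType) (X' : opens X).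

Definition restr_hom (F G : sheaf X) (f : sheaf_hom F G) :
    sheaf_hom (restr X' F) (restr X' G) :=
  @SheafHom _ (restr X' F) (restr X' G) (fun U => f (opens_image U))
    (fun U V h s => happ_res f _ s).

Lemma restr_homE (F G : sheaf X) (f : sheaf_hom F G) U (s : restr X' F U) :
  restr_hom f U s = f (opens_image U) s.
Proof. by []. Qed.

Definition opens_preimage (W : opens X) : opens (set_type X').
Proof.
exists (set_val @^-1` (W : set X)).
by exists (W : set X) => //; exact: openP.
Defined.

Lemma opens_imageS (U : opens (set_type X')) : opens_image U `<=` X'.
Proof. by move=> _ [y _ <-]; exact: set_valP. Qed.

Lemma opens_image_top : X' `<=` opens_image (opens_top (set_type X')).
Proof. by move=> x X'x; exists (exist _ x (mem_set X'x)). Qed.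

Lemma opens_preimageS (W : opens X) : opens_image (opens_preimage W) `<=` W.
Proof. by move=> _ [y Wy <-]. Qed.

Lemma restr_exact (F G H : sheaf X) (f : sheaf_hom F G) (g : sheaf_hom G H) :
  sheaf_exact f g -> sheaf_exact (restr_hom f) (restr_hom g).
Proof.
move=> fg; apply: sheaf_exactI => U s; first exact: (sheaf_exact0 _ fg).
move=> /fg si x Ux.
have [|W [h [t [Wx tE]]]] := si (set_val x); first by exists x.
have hW : opens_preimage W `<=` U.
  by move=> y /h[z Uz /val_inj <-].
exists (opens_preimage W), hW, (res F (@opens_preimageS W) t); split=> //.
rewrite restr_homE -happ_res tE.
rewrite [RHS]/=; exact: (@res_res _ G _ _ _ h (@opens_preimageS W) _ s).
Qed.

Lemma restr_flabby (F : sheaf X) : flabby F -> flabby (restr X' F).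
Proof.
move=> fF U s; have [t <-] := fF (opens_image U) s.
exists (res F (@opens_topS _ _) t).
rewrite [LHS]/=; exact: (@res_res _ F _ _ _ (@opens_topS _ _) _ _ t).
Qed.

Definition restr_complex (C : sheaf_complex X) : sheaf_complex (set_type X') :=
  @SheafComplex _ (fun q => restr X' (C q)) (fun q => restr_hom (sd C q))
    (fun q U s => sdd s).

(** [X'] and the image of the whole subspace have the same points but are different terms of
    [opens X], hence the restrictions back and forth. *)
Lemma restr_acyclic (C : sheaf_complex X) :
  acyclic (sections (restr_complex C) (opens_top (set_type X'))) ->
  acyclic (sections C X').
Proof.
pose T := opens_image (opens_top (set_type X')).
have TX : T `<=` X' by exact: opens_imageS.
have XT : X' `<=` T by exact: opens_image_top.
have resK q (x : C q X') : res (C q) XT (res (C q) TX x) = x.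
  by rewrite (res_res _ _ (subset_trans XT TX)) res_id.
move=> aT q x dx.
have [|y yx] := aT q (res (C q) TX x).
  have /= <- := happ_res (sd C q) TX x.
  rewrite [sd C q _ _]dx; exact: raddf0.
case: q x dx y yx => [|q] x dx y yx.
  by exists 0; rewrite -[RHS]resK -yx /= !raddf0.
exists (res (C q) XT y); rewrite /= -happ_res -[RHS]resK -yx //.
Qed.

End RestrictedComplex.

Section ProductSheaf.
Variables (X : topologicalType) (F G : sheaf X).

Definition prod_sect (U : opens X) : zmodType := (F U * G U)%type.

Definition prod_res_fun (U V : opens X) (h : V `<=` U) (s : prod_sect U) :
  prod_sect V := (res F h s.1, res G h s.2).

Lemma prod_res_B (U V : opens X) (h : V `<=` U) :
  zmod_morphism (prod_res_fun h).
Proof. by move=> s t; congr pair; exact: raddfB. Qed.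

Definition prod_res (U V : opens X) (h : V `<=` U) :
  {additive prod_sect U -> prod_sect V} := additive_of (prod_res_B h).

Lemma prod_res_id (U : opens X) (h : U `<=` U) (s : prod_sect U) :
  prod_res h s = s.
Proof. by case: s => s t; congr pair; exact: res_id. Qed.

Lemma prod_res_res (U V W : opens X) (hVU : V `<=` U) (hWV : W `<=` V)
  (hWU : W `<=` U) (s : prod_sect U) :
  prod_res hWV (prod_res hVU s) = prod_res hWU s.
Proof. by congr pair; exact: res_res. Qed.

Definition prod_psh : presheaf X := Presheaf prod_res_id prod_res_res.

Lemma prod_separated : Defs.separated prod_psh.
Proof.
move=> I U V hVU cov [s s'] [t t'] st; congr pair.
  by apply: (@sheaf_separated _ F _ _ _ hVU cov) => i; have [] := st i.
by apply: (@sheaf_separated _ G _ _ _ hVU cov) => i; have [] := st i.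
Qed.

Lemma prod_gluing : gluing prod_psh.
Proof.
move=> I U V hVU cov s ss.
have [i j|t tE] := @sheaf_gluing _ F _ _ _ hVU cov (fun i => (s i).1).
  by have [] := ss i j.
have [i j|t' tE'] := @sheaf_gluing _ G _ _ _ hVU cov (fun i => (s i).2).
  by have [] := ss i j.
exists (t, t') => i.
transitivity (res F (hVU i) t, res G (hVU i) t') => //.
by rewrite tE tE'; case: (s i).
Qed.

Definition prod_sheaf : sheaf X := Sheaf prod_separated prod_gluing.

Definition prod_fst : sheaf_hom prod_sheaf F :=
  @hom_of _ prod_sheaf F (fun U (s : prod_sect U) => s.1)
    (fun U s t => erefl) (fun U V h s => erefl).

Definition prod_snd : sheaf_hom prod_sheaf G :=
  @hom_of _ prod_sheaf G (fun U (s : prod_sect U) => s.2)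
    (fun U s t => erefl) (fun U V h s => erefl).

Lemma prod_hom_inj (U : opens X) (s t : prod_sheaf U) :
  prod_fst U s = prod_fst U t -> prod_snd U s = prod_snd U t -> s = t.
Proof. by case: s t => [s s'] [t t'] /= -> ->. Qed.

End ProductSheaf.

Section ZeroSheaf.
Variable X : topologicalType.

Definition zero_psh : presheaf X :=
  @Presheaf X (fun=> 'I_1 : zmodType) (fun U V h => idfun)
    (fun U h s => erefl) (fun U V W h h' h'' s => erefl).

Lemma zero_separated : Defs.separated zero_psh.
Proof. by move=> I U V hVU cov s t _; exact: zero_group_eq. Qed.

Lemma zero_gluing : gluing zero_psh.
Proof. by move=> I U V hVU cov s _; exists 0 => i; exact: zero_group_eq. Qed.

Definition zero_sheaf : sheaf X := Sheaf zero_separated zero_gluing.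

End ZeroSheaf.

(** * The mapping cone of a morphism of resolutions *)

Section Cone.
Variables (X : topologicalType) (S : sheaf X) (K L : resolution S).
Variable f : resolution_hom K L.

Definition prev_sheaf (q : nat) : sheaf X :=
  if q is p.+1 then L p else zero_sheaf X.

Definition prev_d (q : nat) : sheaf_hom (prev_sheaf q) (L q) :=
  match q return sheaf_hom (prev_sheaf q) (L q) with
  | 0 => zero_hom (zero_sheaf X) (L 0)
  | p.+1 => sd L p
  end.

Lemma prev_dd q (U : opens X) (s : prev_sheaf q U) :
  sd L q U (prev_d q U s) = 0.
Proof. by case: q s => [|q] s; [exact: raddf0 | exact: sdd]. Qed.

Definition cone_obj (q : nat) : sheaf X := prod_sheaf (K q) (prev_sheaf q).

Definition cone_d_fun (q : nat) (U : opens X) (s : cone_obj q U) :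
    cone_obj q.+1 U :=
  (sd K q U s.1, f q U s.1 - prev_d q U s.2).

Lemma cone_d_B q (U : opens X) : zmod_morphism (@cone_d_fun q U).
Proof.
move=> [s t] [s' t']; congr pair; first exact: raddfB.
by rewrite /= (raddfB (f q U)) (raddfB (prev_d q U)) subrACA.
Qed.

Lemma cone_d_res q (U V : opens X) (h : V `<=` U) (s : cone_obj q U) :
  res (cone_obj q.+1) h (cone_d_fun s) = cone_d_fun (res (cone_obj q) h s).
Proof.
by congr pair; rewrite ?(raddfB (res (L q) h)) !happ_res.
Qed.

Definition cone_d q : sheaf_hom (cone_obj q) (cone_obj q.+1) :=
  hom_of (@cone_d_B q) (@cone_d_res q).

Lemma cone_dd q (U : opens X) (s : cone_obj q U) :
  cone_d q.+1 U (cone_d q U s) = 0.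
Proof.
congr pair; first exact: sdd.
by rewrite /= (raddfB (sd L q U)) prev_dd subr0 rhom_d subrr.
Qed.

Definition cone : sheaf_complex X := SheafComplex cone_dd.

(** A degree 0 cocycle of [K] comes locally from [S]; if [f] kills it, so does the augmentation of
    [L], which is injective. *)
Lemma cone_inj (U : opens X) : injective (sd cone 0 U).
Proof.
apply: raddf_inj => -[k l] kl.
have /(@raug_exact _ _ K) ki : sd K 0 U k = 0 := congr1 fst kl.
have fk : f 0 U k = 0.
  by rewrite -[LHS]subr0; exact: (congr1 snd kl).
congr pair; last exact: zero_group_eq.
apply: same_germ_eq => x Ux; have [W [h [s [Wx sE]]]] := ki x Ux.
exists W, h, h; split=> //; rewrite raddf0 -sE.
suff -> : s = 0 by rewrite raddf0.
by apply: (@raug_inj _ _ L W); rewrite -(rhom_aug f) sE -happ_res fk !raddf0.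
Qed.

(** A local primitive [k'] of [k] makes [f k' - l] a cocycle of [L], to which exactness of [L]
    applies. *)
Lemma cone_exact q : sheaf_exact (sd cone q) (sd cone q.+1).
Proof.
apply: sheaf_exactI; first exact: cone_dd.
move=> U [k l] kl x Ux.
have dk : sd K q.+1 U k = 0 := congr1 fst kl.
have fk : f q.+1 U k = sd L q U l.
  by apply/eqP; rewrite -subr_eq0; apply/eqP; exact: (congr1 snd kl).
have /(@rexact _ _ K q)/(_ x Ux)[W [h [k' [Wx kE]]]] := dk.
have dl : sd L q W (f q W k' - res (L q) h l) = 0.
  by rewrite raddfB rhom_d kE -!happ_res fk subrr.
case: q k l {kl} dk fk k' kE dl => [|q] k l dk fk k' kE dl.
  have /(@raug_exact _ _ L)/(_ x Wx)[V [hV [s [Vx sE]]]] := dl.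
  (* When [l] has degree 0 that cocycle comes from a section [s] of [S], and [k'] is corrected by
     the augmentation of [s]. *)
  exists V, (subset_trans hV h), (res (K 0%N) hV k' - raug K V s, 0).
  split=> //.
  congr pair.
    rewrite /= raddfB (sheaf_exact0 _ (@raug_exact _ _ K)) subr0.
    by rewrite -happ_res kE; exact: res_res.
  rewrite [LHS]subr0 raddfB /= rhom_aug sE raddfB -happ_res.
  by rewrite opprB addrC subrK; exact: res_res.
have /(@rexact _ _ L q)/(_ x Wx)[V [hV [l' [Vx lE]]]] := dl.
exists V, (subset_trans hV h), (res (K q.+1) hV k', l'); split=> //.
congr pair.
  by rewrite /= -happ_res kE; exact: res_res.
rewrite /= lE raddfB -happ_res.
by rewrite opprB addrC subrK; exact: res_res.
Qed.

Lemma cone_soft : soft_resolution K -> soft_resolution L ->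
  forall q, soft (cone q).
Proof.
move=> sK sL q.
apply: (@joint_soft _ _ _ _ (prod_fst (K q) (prev_sheaf q))
          (prod_snd (K q) (prev_sheaf q))).
- exact: prod_hom_inj.
- by move=> g g'; exists (g, g').
- exact: sK.
- case: q => [|q]; last exact: sL.
  by apply: trivial_soft => U s t; exact: zero_group_eq.
Qed.

Lemma restr_cone_soft (X' : opens X) : soft_over X' K -> soft_over X' L ->
  forall q, soft (restr X' (cone q)).
Proof.
move=> sK sL q.
apply: (@joint_soft _ _ _ _ (restr_hom X' (prod_fst (K q) (prev_sheaf q)))
          (restr_hom X' (prod_snd (K q) (prev_sheaf q)))).
- by move=> U; exact: prod_hom_inj.
- by move=> g g'; exists (g, g').
- exact: sK.
- case: q => [|q]; last exact: sL.
  by apply: trivial_soft => U s t; exact: zero_group_eq.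
Qed.

End Cone.

(** * Comparison of the complexes *)

Lemma inj_surj_bijective (A B : Type) (f : A -> B) :
  injective f -> (forall y, exists x, f x = y) -> bijective f.
Proof.
by move=> finj /choice[g gP]; exists g => // x; apply: finj; rewrite gP.
Qed.

Lemma cclass_eq0 (C : cochain) q (z : cocycles C q) :
  cclass C q z = 0 <-> exists y : cprev C q, cdprev C q y = ker_val z.
Proof.
rewrite -(raddf0 (cclass C q)); split=> [/cclassP[y yE]|[y yE]].
  by exists y; rewrite yE subr0.
by apply/cclassP; exists y; rewrite yE subr0.
Qed.

Lemma cohom_bijective (C D : cochain) (f : chain_map C D) q :
  (forall (x : C q) (y : cprev D q), cd C q x = 0 -> cdprev D q y = f q x ->
     exists y' : cprev C q, cdprev C q y' = x) ->
  (forall u : D q, cd D q u = 0 -> exists (x : C q) (y : cprev D q),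
     cd C q x = 0 /\ cdprev D q y = f q x - u) ->
  bijective (cohom_map f q).
Proof.
move=> finj fsurj; apply: inj_surj_bijective.
  apply: raddf_inj => c; have [z <-] := cclass_surj c.
  rewrite [cohom_map _ _ _]cohom_funE => /cclass_eq0[y yE].
  by apply/cclass_eq0; apply: finj yE; exact: kerP.
move=> c; have [z <-] := cclass_surj c.
have [x [y [dx yE]]] := fsurj (ker_val z) (kerP z).
exists (cclass C q (to_ker dx)).
by rewrite [LHS]cohom_funE; apply/cclassP; exists y.
Qed.

Lemma cohom_map_comp (C D D' E : cochain) (f : chain_map C D)
  (g : chain_map D E) (f' : chain_map C D') (g' : chain_map D' E) :
  (forall q (x : C q), g q (f q x) = g' q (f' q x)) ->
  forall q (x : cohom C q),
    cohom_map g q (cohom_map f q x) = cohom_map g' q (cohom_map f' q x).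
Proof.
move=> gf q c; have [z <-] := cclass_surj c.
rewrite [cohom_map f _ _]cohom_funE [LHS]cohom_funE.
rewrite [cohom_map f' _ _]cohom_funE [RHS]cohom_funE.
by congr (cclass E q _); apply: val_inj; exact: gf.
Qed.

Lemma emb_acyclic (X : topologicalType) (X' : opens X) (C : sheaf_complex X) :
  acyclic (sections C (opens_top X)) -> acyclic (sections C X') ->
  acyclic (emb_complex X' C).
Proof.
move=> aX aX' q [s t] st.
have ds : sd C q (opens_top X) s = 0 := congr1 fst st.
have rs : restr_to X' C q s = cdprev (sections C X') q t.
  by apply/eqP; rewrite -subr_eq0; apply/eqP; exact: (congr1 snd st).
have [s' s'E] := aX q s ds.
case: q s t {st} ds rs s' s'E => [|q] s t ds rs s' s'E.
  by exists 0; rewrite -s'E; congr pair; exact: zero_group_eq.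
have [|t' t'E] := aX' q (restr_to X' C q s' - t).
  rewrite (raddfB (cd (sections C X') q)) restr_to_d.
  by rewrite [cd _ _ s']s'E rs subrr.
exists (s', t'); congr pair; first exact: s'E.
by rewrite /= t'E opprB addrC subrK.
Qed.

Section ConeQuasiIso.
Variables (X : topologicalType) (X' : opens X) (S : sheaf X).
Variables (K L : resolution S) (f : resolution_hom K L).

(** The two groups coincide by computation, but only after a case analysis on [q]. *)
Definition to_prev q : cprev (sections L X') q -> prev_sheaf L q X' :=
  if q is p.+1 then id else id.

Lemma prev_d_to_prev q (m : cprev (sections L X') q) :
  prev_d L q X' (to_prev m) = cdprev (sections L X') q m.
Proof. by case: q m. Qed.

(** Up to reordering and a sign, the embedding complex of [cone f] is the cone of [emb_map X' f],
    and acyclicity of a cone gives a quasi-isomorphism. *)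
Lemma emb_map_bijective : acyclic (emb_complex X' (cone f)) ->
  forall q, bijective (cohom_map (emb_map X' f) q).
Proof.
move=> ac q; apply: cohom_bijective => [[k t] y kt ykt|[l m] lm].
  have dk : sd K q (opens_top X) k = 0 := congr1 fst kt.
  have rk : restr_to X' K q k = cdprev (sections K X') q t.
    by apply/eqP; rewrite -subr_eq0; apply/eqP; exact: (congr1 snd kt).
  case: q k t y {kt} ykt dk rk => [|q] k t y ykt dk rk.
    have fk : f 0 _ k = 0 := esym (congr1 fst ykt).
    have [|y' y'E] := ac 0%N ((k, 0), 0).
      congr pair; first by congr pair; [exact: dk|rewrite /= fk subr0].
      by rewrite /= subr0; congr pair; exact: rk.
    exists 0; rewrite raddf0; congr pair; last exact: zero_group_eq.
    exact: (congr1 (fun u => u.1.1) y'E).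
  case: y ykt => l m ykt.
  have dl : sd L q _ l = f q.+1 _ k := congr1 fst ykt.
  have rl : restr_to X' L q l - cdprev (sections L X') q m = f q X' t :=
    congr1 snd ykt.
  have m'E := prev_d_to_prev m; set m' := to_prev m in m'E.
  (* That the image of [(k, t)] is the coboundary of [(l, m)] makes this element a cocycle; its
     primitive contains one of [(k, t)]. *)
  have [|[[k' l'] c] y'E] := ac q.+1 ((k, l), (t, - m')).
    congr pair; first by congr pair; [exact: dk|rewrite /= dl subrr].
    congr pair => /=; first by apply/eqP; rewrite subr_eq0 rk.
    rewrite (raddfN (prev_d L q X')) opprK m'E -rl subrK.
    exact: subrr.
  have dk' : sd K q _ k' = k := congr1 (fun u => u.1.1) y'E.
  have rk' : restr_to X' K q k' - (cdprev (sections (cone f) X') q c).1 = t :=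
    congr1 (fun u => u.2.1) y'E.
  have [t' t'E] : exists t' : cprev (sections K X') q,
      cdprev (sections K X') q t' = (cdprev (sections (cone f) X') q c).1.
    by case: (q) c {y'E rk'} => [|p] c; [exists 0 | exists c.1].
  by exists (k', t'); congr pair => //=; rewrite t'E.
have dl : sd L q (opens_top X) l = 0 := congr1 fst lm.
have rl : restr_to X' L q l = cdprev (sections L X') q m.
  by apply/eqP; rewrite -subr_eq0; apply/eqP; exact: (congr1 snd lm).
have m'E := prev_d_to_prev m.
(* The cocycle [(l, m)] is completed by zeros; the [K] part of the primitive is a preimage of its
   class. *)
have [|[[k l'] c] y'E] := ac q.+1 ((0, l), (0, - to_prev m)).
  congr pair.
    congr pair => /=; first exact: raddf0.
    by rewrite dl subr0; exact: raddf0.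
  congr pair => /=.
    by rewrite (raddf0 (restr_to X' K q.+1)) (raddf0 (sd K q X')) subrr.
  rewrite (raddf0 (f q X')) (raddfN (prev_d L q X')) sub0r opprK m'E -rl.
  exact: subrr.
have dk : sd K q _ k = 0 := congr1 (fun u => u.1.1) y'E.
have fk : f q _ k - prev_d L q _ l' = l := congr1 (fun u => u.1.2) y'E.
have rk : restr_to X' K q k - (cdprev (sections (cone f) X') q c).1 = 0 :=
  congr1 (fun u => u.2.1) y'E.
have rl' : res (prev_sheaf L q) (@opens_topS X X') l'
    - (cdprev (sections (cone f) X') q c).2 = - to_prev m :=
  congr1 (fun u => u.2.2) y'E.
case: q k l m c l' {lm y'E dl m'E rl} dk fk rk rl'
    => [|q] k l m c l' dk fk rk rl'.
  exists (k, 0), 0; split; first by congr pair; [exact: dk | exact: rk].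
  rewrite raddf0; congr pair; last exact: zero_group_eq.
  by apply/eqP; rewrite eq_sym subr_eq0 -fk /= subr0.
case: c rk rl' => t n rk rl'.
have [n' n'E] : exists n' : cprev (sections L X') q,
    cdprev (sections L X') q n' = - prev_d L q X' n.
  by case: (q) n {rl' rk} => [|p] n; exists (- n); rewrite ?raddfN.
exists (k, t), (l', n'); split; first by congr pair; [exact: dk | exact: rk].
congr pair => /=; first by rewrite -fk opprB addrC subrK.
rewrite n'E opprK.
move: rl' => /(congr1 (fun u => f q X' t + u)) <-.
by rewrite addrCA opprB; congr (_ + _); rewrite addrC subrK.
Qed.

End ConeQuasiIso.

Lemma soft_emb_map_bijective (X : topologicalType) (X' : opens X) (S : sheaf X)
  (K L : resolution S) (f : resolution_hom K L) :
  paracompact X -> paracompact (set_type X') ->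
  soft_resolution K -> soft_over X' K -> soft_resolution L -> soft_over X' L ->
  forall q, bijective (cohom_map (emb_map X' f) q).
Proof.
move=> pX pX' sK sK' sL sL'; apply: emb_map_bijective; apply: emb_acyclic.
  apply: exact_soft_acyclic => //.
  - exact: cone_inj.
  - exact: cone_exact.
  - exact: cone_soft.
apply: restr_acyclic; apply: exact_soft_acyclic => //.
- by move=> U; exact: (@cone_inj _ _ _ _ f (opens_image U)).
- by move=> q; exact/restr_exact/cone_exact.
- exact: restr_cone_soft.
Qed.

(** The second component of a cochain extends over [X] by flabbiness, and a coboundary then removes
    it. *)
Lemma rel_emb_bijective (X : topologicalType) (X' : opens X)
  (C : sheaf_complex X) : (forall q, flabby (C q)) ->
  forall q, bijective (cohom_map (rel_emb X' C) q).
Proof.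
move=> fC.
have ext q (t : C q X') : exists s, restr_to X' C q s = t := fC q X' t.
have ext' q (t : cprev (sections C X') q) :
    exists s : cprev (sections C (opens_top X)) q,
      restr_to X' C q (cdprev (sections C (opens_top X)) q s) =
      cdprev (sections C X') q t.
  case: q t => [|q] t; first by exists 0; rewrite !raddf0.
  have [s <-] := ext q t; exists s.
  exact/esym/restr_to_d.
move=> q; apply: cohom_bijective => [x y dx yE|[k t] kt].
  case: q x y dx yE => [|q] x y dx yE.
    exists 0; rewrite raddf0; apply: val_inj.
    exact: (congr1 fst yE).
  case: y yE => l m yE.
  have dl : sd C q _ l = ker_val x := congr1 fst yE.
  have rl : restr_to X' C q l - cdprev (sections C X') q m = 0 := congr1 snd yE.
  have [s sE] := ext' q m.
  have l0 : restr_to X' C q (l - cdprev (sections C (opens_top X)) q s) = 0.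
    by rewrite (raddfB (restr_to X' C q)) sE.
  exists (to_ker l0); apply: val_inj => /=.
  rewrite (raddfB (sd C q _)) dl.
  suff -> : sd C q _ (cdprev (sections C (opens_top X)) q s) = 0.
    by rewrite subr0.
  case: (q) s {sE l0} => [|p] s; first by rewrite raddf0.
  exact: sdd.
have dk : sd C q (opens_top X) k = 0 := congr1 fst kt.
have rk : restr_to X' C q k = cdprev (sections C X') q t.
  by apply/eqP; rewrite -subr_eq0; apply/eqP; exact: (congr1 snd kt).
case: q k t {kt} dk rk => [|q] k t dk rk.
  exists (to_ker rk : rel_complex X' C 0%N), 0; split; first exact: val_inj.
  by rewrite raddf0; congr pair; [rewrite subrr | exact: zero_group_eq].
have [s sE] := ext q t.
have r0 : restr_to X' C q.+1 (k - sd C q _ s) = 0.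
  by rewrite (raddfB (restr_to X' C q.+1)) rk -restr_to_d sE subrr.
exists (to_ker r0 : rel_complex X' C q.+1), (- s, 0); split.
  by apply: val_inj; rewrite /= raddfB dk sdd subr0.
congr pair => /=; first by rewrite raddfN addrAC subrr sub0r.
by rewrite raddf0 subr0 raddfN sE sub0r.
Qed.

(** The default [\0] lets [inj_to_rel] be defined for every resolution. *)
Lemma additive_inverse (A B : zmodType) (f : {additive A -> B}) :
  exists g : {additive B -> A}, bijective f -> cancel f g /\ cancel g f.
Proof.
have [[g fK gK]|nf] := pselect (bijective f); last by exists \0.
exists (additive_of (can2_zmod_morphism fK gK)); split; [exact: fK | exact: gK].
Qed.

(** * The canonical comparison map and its naturality *)

Section Comparison.
Variables (X : topologicalType) (X' : opens X) (S : sheaf X).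
Local Notation I := (inj_resolution S).

Definition inj_lift_map (K : resolution S) : resolution_hom K I :=
  projT1 (cid (inj_lift K)).

Definition emb_to_inj (K : resolution S) q :
    {additive cohom (emb_complex X' K) q -> cohom (emb_complex X' I) q} :=
  cohom_map (emb_map X' (inj_lift_map K)) q.

Definition rel_to_inj (F : resolution S) q :
    {additive cohom (rel_complex X' F) q -> cohom (emb_complex X' I) q} :=
  emb_to_inj F q \o cohom_map (rel_emb X' F) q.

Definition inj_to_rel (F : resolution S) q :
    {additive cohom (emb_complex X' I) q -> cohom (rel_complex X' F) q} :=
  projT1 (cid (additive_inverse (rel_to_inj F q))).

Definition comparison (K F : resolution S) q :
    {additive cohom (emb_complex X' K) q -> cohom (rel_complex X' F) q} :=
  inj_to_rel F q \o emb_to_inj K q.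

Lemma comparisonE (K F : resolution S) q x :
  comparison K F q x = inj_to_rel F q (emb_to_inj K q x).
Proof. by []. Qed.

(** [f] followed by the lift of [L], and the lift chosen for [K], are both morphisms from [K] to the
    injective resolution, hence homotopic. *)
Lemma emb_to_inj_natural (K L : resolution S) (f : resolution_hom K L) q x :
  emb_to_inj L q (cohom_map (emb_map X' f) q x) = emb_to_inj K q x.
Proof.
pose h := inj_lift_map L.
have hfd q' (U : opens X) (s : K q' U) :
    sd I q' U (comp_hom (h q') (f q') U s) =
    comp_hom (h q'.+1) (f q'.+1) U (sd K q' U s).
  by rewrite !comp_homE !rhom_d.
have hfa (U : opens X) (s : S U) :
    comp_hom (h 0%N) (f 0%N) U (raug K U s) = raug I U s.
  by rewrite comp_homE !rhom_aug.
pose hf := ResolutionHom hfd hfa.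
have [s [s0 sS]] := inj_lift_homotopy hf (inj_lift_map K).
rewrite -[RHS](emb_homotopy s0 sS).
have [z <-] := cclass_surj x.
rewrite [cohom_map (emb_map X' f) _ _]cohom_funE.
rewrite [LHS]cohom_funE [RHS]cohom_funE.
congr (cclass _ q _); apply: val_inj; congr pair.
by case: (q) z => [|p] z.
Qed.

(** The inclusions [rel_emb] commute with [g] already on cochains, which reduces this to
    [emb_to_inj_natural]. *)
Lemma rel_to_inj_natural (F G : resolution S) (g : resolution_hom F G) q y :
  rel_to_inj G q (cohom_map (rel_map X' g) q y) = rel_to_inj F q y.
Proof.
rewrite /= -(emb_to_inj_natural g); congr (emb_to_inj G q _).
apply: cohom_map_comp => p x; congr pair.
by rewrite /= raddf0.
Qed.

End Comparison.

Lemma flabby_resolution_soft (X : topologicalType) (X' : opens X) (S : sheaf X)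
  (F : resolution S) : paracompact X -> paracompact (set_type X') ->
  flabby_resolution F -> soft_resolution F /\ soft_over X' F.
Proof.
move=> pX pX' fF; split=> q; first exact: flabby_soft.
by apply: flabby_soft => //; exact: restr_flabby.
Qed.

(* The isomorphisms Phi K F q are canonical: they are natural in the soft
   resolution K and in the flabby resolution F used to compute H(X, X'; S), and
   for K = F the map Phi F F q is the inverse of the map induced by the
   inclusion s |-> (s, 0) of F(X, X') into F(i). *)
Theorem theorem2p23 (X : topologicalType) (X' : opens X) (S : sheaf X)
  (hX : paracompact X) (hX' : paracompact (set_type X')) :
  exists Phi : forall (K F : resolution S) (q : nat),
      {additive cohom (emb_complex X' K) q -> cohom (rel_complex X' F) q},
    [/\ forall K F : resolution S,
          soft_resolution K -> soft_over X' K -> flabby_resolution F ->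
          forall q, bijective (Phi K F q),
        forall (K L F : resolution S) (f : resolution_hom K L),
          soft_resolution K -> soft_over X' K ->
          soft_resolution L -> soft_over X' L -> flabby_resolution F ->
          forall q (x : cohom (emb_complex X' K) q),
            Phi L F q (cohom_map (emb_map X' f) q x) = Phi K F q x,
        forall (K F G : resolution S) (g : resolution_hom F G),
          soft_resolution K -> soft_over X' K ->
          flabby_resolution F -> flabby_resolution G ->
          forall q (x : cohom (emb_complex X' K) q),
            cohom_map (rel_map X' g) q (Phi K F q x) = Phi K G q x
      & forall F : resolution S, flabby_resolution F ->
          forall q (y : cohom (rel_complex X' F) q),
            Phi F F q (cohom_map (rel_emb X' F) q y) = y].
Proof.
have [sI sI'] := flabby_resolution_soft hX hX' (@inj_flabby X S).
have embE (K : resolution S) : soft_resolution K -> soft_over X' K ->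
    forall q, bijective (emb_to_inj X' K q).
  by move=> sK sK' q; exact: soft_emb_map_bijective.
have relE (F : resolution S) : flabby_resolution F ->
    forall q, bijective (rel_to_inj X' F q).
  move=> fF q; have [sF sF'] := flabby_resolution_soft hX hX' fF.
  by apply: bij_comp; [exact: embE | exact: rel_emb_bijective].
have invE (F : resolution S) : flabby_resolution F -> forall q,
    cancel (rel_to_inj X' F q) (inj_to_rel X' F q) /\
    cancel (inj_to_rel X' F q) (rel_to_inj X' F q).
  by move=> fF q; apply: (projT2 (cid (additive_inverse _))); exact: relE.
exists (comparison X' (S := S)); split.
- move=> K F sK sK' fF q; have [relK invK] := invE F fF q.
  by apply: bij_comp; [exists (rel_to_inj X' F q) | exact: embE].
- move=> K L F f _ _ _ _ _ q x.
  by rewrite !comparisonE emb_to_inj_natural.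
- move=> K F G g _ _ fF fG q x.
  have [relK _] := invE G fG q; have [_ invK] := invE F fF q.
  (* Both sides are compared after the injective map [rel_to_inj] of [G], where the inverses
     cancel. *)
  apply: (can_inj relK); rewrite rel_to_inj_natural !comparisonE.
  by have [_ invK'] := invE G fG q; rewrite invK invK'.
- by move=> F fF q y; have [relK _] := invE F fF q; exact: relK.
Qed.
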